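(* Let $A$ and $B$ be connected weak Hopf algebras over a field $\mathbb{F}$, let $k:A\to B$ be an Inv-normal weak Hopf algebra homomorphism, and let $\pi:B\to H$ be the cokernel map of $k$. Then the relative restriction of scalars induces an equivalence $\pi^*:\mathrm{Rep}(H)\xrightarrow{\ \sim\ }\mathrm{Ker}\,k^*$.
   Context: Fix a field $\mathbb{F}$. Sweedler notation without summation sign is used: $\Delta(a)=a^{(1)}\otimes a^{(2)}$. A weak Hopf algebra is a unital associative algebra $A$ that is also a coassociative counital coalgebra, with a linear map $S:A\to A$, such that for all $a,b,c\in A$: $\Delta(ab)=\Delta(a)\Delta(b)$; $(\Delta\otimes\mathrm{id})\Delta(1)=(\Delta(1)\otimes 1)(1\otimes\Delta(1))=(1\otimes\Delta(1))(\Delta(1)\otimes 1)$; $\epsilon(abc)=\epsilon(ab^{(1)})\epsilon(b^{(2)}c)=\epsilon(ab^{(2)})\epsilon(b^{(1)}c)$; $a^{(1)}S(a^{(2)})=\epsilon(1^{(1)}a)1^{(2)}$; $S(a^{(1)})a^{(2)}=1^{(1)}\epsilon(a1^{(2)})$; $S(a^{(1)})a^{(2)}S(a^{(3)})=S(a)$. Put $\epsilon_t(a)=a^{(1)}S(a^{(2)})$ and $A_t=\epsilon_t(A)$. $\mathrm{Rep}(A)$ is the category of finite-dimensional left $A$-modules, monoidal with $M\otimes^A N=\Delta(1)(M\otimes N)$ (action via $\Delta$) and unit object $A_t$ with action $a\cdot x=\epsilon_t(ax)$. $A$ is connected if it satisfies the following conditions (treated as equivalent): $A_t$ is a simple $A$-module;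 $Z(A)\cap A_t=\mathbb{F}1_A$; $\mathrm{End}_A(A_t)=\mathbb{F}\,\mathrm{id}_{A_t}$. A weak Hopf algebra homomorphism is a unital algebra homomorphism that is a counital coalgebra homomorphism and commutes with antipodes; $k^*:\mathrm{Rep}(B)\to\mathrm{Rep}(A)$ is restriction of scalars, and $\mathrm{Ker}\,k^*\subseteq\mathrm{Rep}(B)$ is the full subcategory of objects $M$ with $k^*(M)\cong A_t^{\oplus n}$ for some $n\ge 0$. $\mathrm{Inv}_A(M)=\{m\in M\mid a\cdot m=\epsilon_t(a)\cdot m\ \ \forall a\in A\}$; $k$ is Inv-normal if $B\cdot\mathrm{Inv}_A(k^*(M))=k(A)\cdot\mathrm{Inv}_A(k^*(M))$ for every $M\in\mathrm{Rep}(B)$ (products denote linear spans). A linear map $\pi:B\to C$ to an associative algebra is birelatively multiplicative if $\pi(aS(1^{(1)}))\pi(1^{(2)}b)=\pi(ab)=\pi(a1^{(1)})\pi(S(1^{(2)})b)$ for all $a,b\in B$. The cokernel of $k$ is the universal pair $(H,\pi)$ with $H$ a unital associative algebra and $\pi:B\to H$ birelatively multiplicative with $\pi(k(a))=\epsilon_A(a)1_H$ for all $a\in A$ (every other such pair factors through it by a unique unital algebra homomorphism). It exists, $H$ is a Hopf algebra, and $\pi$ is a counital coalgebra homomorphism commuting with antipodes. The relative restriction of scalars $\pi^*:\mathrm{Rep}(H)\to\mathrm{Rep}(B)$ is $\pi^*(M)=B_t\otimes M/\mathrm{span}\{x\otimes m-S(1^{(1)})\otimes\pi(1^{(2)}x)m\mid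 x\in B_t,\,m\in M\}$, with $x\boxtimes m$ the class of $x\otimes m$, action $b\cdot(x\boxtimes m)=S(1^{(1)})\boxtimes\pi(1^{(2)}bx)m$, and $\pi^*(f)(x\boxtimes m)=x\boxtimes f(m)$. *)

(* Defs.v *)
From HB Require Import structures.
From mathcomp Require Import all_boot all_algebra.
From mathcomp Require Import boolp.

Set Implicit Arguments.
Unset Strict Implicit.
Unset Printing Implicit Defensive.

Import GRing.Theory.

Local Open Scope ring_scope.
Local Open Scope quotient_scope.

Reserved Notation "x \ox y" (at level 40, left associativity).
Reserved Notation "\tsum_ ( x , y <- t ) E"
  (at level 41, E at level 41, x binder, y binder, t at level 50,
   format "'[' \tsum_ ( x ,  y  <-  t ) '/  '  E ']'").

Section Tensor.
Variables (F : fieldType) (V W : lmodType F).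

(* The tensor product V (x) W over F is the type of formal sums of pairs modulo the congruence generated
   by the bilinearity relations. *)
Inductive tensor_eq : seq (V * W) -> seq (V * W) -> Prop :=
| tensor_refl s : tensor_eq s s
| tensor_sym s t : tensor_eq s t -> tensor_eq t s
| tensor_trans s t u : tensor_eq s t -> tensor_eq t u -> tensor_eq s u
| tensor_cat s s' t t' :
    tensor_eq s s' -> tensor_eq t t' -> tensor_eq (s ++ t) (s' ++ t')
| tensor_catC s t : tensor_eq (s ++ t) (t ++ s)
| tensor_addl v v' w : tensor_eq [:: (v + v', w)] [:: (v, w); (v', w)]
| tensor_addr v w w' : tensor_eq [:: (v, w + w')] [:: (v, w); (v, w')]
| tensor_scale c v w : tensor_eq [:: (c *: v, w)] [:: (v, c *: w)]
| tensor_zero w : tensor_eq [:: (0, w)] [::].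

Definition tensor_eqb (s t : seq (V * W)) : bool := `[< tensor_eq s t >].

Lemma tensor_eqb_equiv : equiv_class_of tensor_eqb.
Proof.
split=> [s|s t|s t u].
- exact/asboolP/tensor_refl.
- by apply/idP/idP => /asboolP st; apply/asboolP/tensor_sym.
- by move=> /asboolP st /asboolP tu; apply/asboolP; apply: tensor_trans st tu.
Qed.

Canonical tensor_equiv := EquivRelPack tensor_eqb_equiv.
Canonical tensor_encModRel := defaultEncModRel tensor_eqb.

Definition tensor := {eq_quot tensor_eqb}.
HB.instance Definition _ := EqQuotient.on tensor.
HB.instance Definition _ := Choice.on tensor.

Lemma tensor_piP s t : tensor_eq s t <-> \pi_tensor s = \pi_tensor t.
Proof.
split=> [st|/eqP]; first by apply/eqP; rewrite piE; apply/asboolP.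
by rewrite piE => /asboolP.
Qed.

Lemma tensor_reprK s : tensor_eq (repr (\pi_tensor s)) s.
Proof. by apply/tensor_piP; rewrite reprK. Qed.

Lemma tensor_map (f : V * W -> V * W) s t :
    (forall v v' w, tensor_eq [:: f (v + v', w)] [:: f (v, w); f (v', w)]) ->
    (forall v w w', tensor_eq [:: f (v, w + w')] [:: f (v, w); f (v, w')]) ->
    (forall c v w, tensor_eq [:: f (c *: v, w)] [:: f (v, c *: w)]) ->
    (forall w, tensor_eq [:: f (0, w)] [::]) ->
  tensor_eq s t -> tensor_eq (map f s) (map f t).
Proof.
move=> fDl fDr fZ f0; elim=> //=.
- by move=> *; apply: tensor_refl.
- by move=> *; apply: tensor_sym.
- by move=> ? ? ? _ st _; apply: tensor_trans.
- by move=> *; rewrite !map_cat; apply: tensor_cat.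
- by move=> *; rewrite !map_cat; apply: tensor_catC.
Qed.

Definition tensor_scal (c : F) (t : tensor) : tensor :=
  \pi_tensor [seq (c *: p.1, p.2) | p <- repr t].
Definition tensor_add (t u : tensor) : tensor := \pi_tensor (repr t ++ repr u).
Definition tensor_opp (t : tensor) : tensor := tensor_scal (-1) t.

Lemma tensor_addE s t :
  tensor_add (\pi_tensor s) (\pi_tensor t) = \pi_tensor (s ++ t).
Proof. by apply/tensor_piP/tensor_cat; apply: tensor_reprK. Qed.

Lemma tensor_scalE c s :
  tensor_scal c (\pi_tensor s) = \pi_tensor [seq (c *: p.1, p.2) | p <- s].
Proof.
apply/tensor_piP/tensor_map; last exact: tensor_reprK.
- by move=> v v' w /=; rewrite scalerDr; apply: tensor_addl.
- by move=> v w w' /=; apply: tensor_addr.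
- by move=> d v w /=; rewrite scalerA mulrC -scalerA; apply: tensor_scale.
- by move=> w /=; rewrite scaler0; apply: tensor_zero.
Qed.

Lemma tensor_ind (P : tensor -> Prop) :
  (forall s, P (\pi_tensor s)) -> forall t, P t.
Proof. by move=> Ps t; rewrite -[t]reprK. Qed.

Lemma tensor_addA : associative tensor_add.
Proof.
by elim/tensor_ind=> s; elim/tensor_ind=> t; elim/tensor_ind=> u;
  rewrite !tensor_addE catA.
Qed.

Lemma tensor_addC : commutative tensor_add.
Proof.
elim/tensor_ind=> s; elim/tensor_ind=> t; rewrite !tensor_addE.
exact/tensor_piP/tensor_catC.
Qed.

Lemma tensor_add0 : left_id (\pi_tensor [::]) tensor_add.
Proof. by elim/tensor_ind=> s; rewrite tensor_addE. Qed.

Lemma tensor_scalDr c : {morph tensor_scal c : t u / tensor_add t u}.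
Proof.
by elim/tensor_ind=> s; elim/tensor_ind=> t;
  rewrite !(tensor_addE, tensor_scalE) map_cat.
Qed.

Lemma tensor_scalDl t c d :
  tensor_scal (c + d) t = tensor_add (tensor_scal c t) (tensor_scal d t).
Proof.
elim/tensor_ind: t => s; rewrite !tensor_scalE tensor_addE.
elim: s => [//|[v w] s /tensor_piP IHs] /=; apply/tensor_piP.
have st (s1 s2 s3 : seq (V * W)) : tensor_eq (s1 ++ s2 ++ s3) (s2 ++ s1 ++ s3).
  by rewrite !catA; apply: tensor_cat (tensor_catC _ _) (tensor_refl _).
rewrite -cat1s -[_ :: _ ++ _]cat1s.
apply: tensor_trans (_ : tensor_eq ([:: (c *: v, w); (d *: v, w)] ++ _) _).
  by rewrite scalerDl; apply: tensor_cat (tensor_addl _ _ _) IHs.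
rewrite -[[:: _; _]]cat1s -catA; apply: tensor_cat (tensor_refl _) _.
exact: st.
Qed.

Lemma tensor_addN : left_inverse (\pi_tensor [::]) tensor_opp tensor_add.
Proof.
move=> t; have {2}-> : t = tensor_scal 1 t.
  elim/tensor_ind: t => s; rewrite tensor_scalE; congr (\pi_tensor _).
  by elim: s => //= -[v w] s <-; rewrite scale1r.
rewrite -tensor_scalDl addNr; elim/tensor_ind: t => s.
rewrite tensor_scalE; apply/tensor_piP.
elim: s => [|p s IHs] /=; first exact: tensor_refl.
rewrite -cat1s -[[::]]cats0; apply: tensor_cat IHs.
by rewrite scale0r; apply: tensor_zero.
Qed.

HB.instance Definition _ :=
  GRing.isZmodule.Build tensor tensor_addA tensor_addC tensor_add0 tensor_addN.

Lemma tensor_scalA c d t :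
  tensor_scal c (tensor_scal d t) = tensor_scal (c * d) t.
Proof.
elim/tensor_ind: t => s; rewrite !tensor_scalE -map_comp.
by congr (\pi_tensor _); apply: eq_map => p /=; rewrite scalerA.
Qed.

Lemma tensor_scal1 : left_id 1 tensor_scal.
Proof.
elim/tensor_ind=> s; rewrite tensor_scalE; congr (\pi_tensor _).
by elim: s => //= -[v w] s ->; rewrite scale1r.
Qed.

HB.instance Definition _ := GRing.Zmodule_isLmodule.Build F tensor
  tensor_scalA tensor_scal1 tensor_scalDr tensor_scalDl.

Lemma tensorDE s t : \pi_tensor s + \pi_tensor t = \pi_tensor (s ++ t).
Proof. exact: tensor_addE. Qed.

Lemma tensorZE c s :
  c *: \pi_tensor s = \pi_tensor [seq (c *: p.1, p.2) | p <- s].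
Proof. exact: tensor_scalE. Qed.

Definition pure (v : V) (w : W) : tensor := \pi_tensor [:: (v, w)].

(* \tsum_(x, y <- Delta a) E x y is the Sweedler expression E(a_(1), a_(2)); an
   element of V (x) W is not a pure tensor in general. The value does not depend on the chosen formal sum
   representing t as soon as E is bilinear (tsum_pure, tsumP). *)
Definition tsum (Z : nmodType) (t : tensor) (E : V -> W -> Z) : Z :=
  \sum_(p <- repr t) E p.1 p.2.

Definition bilin (Z : lmodType F) (E : V -> W -> Z) : Prop :=
  (forall w, linear (E^~ w)) /\ (forall v, linear (E v)).

End Tensor.

Notation "x \ox y" := (pure x y) : ring_scope.
Notation "\tsum_ ( x , y <- t ) E" := (tsum t (fun x y => E)) : ring_scope.

Section TensorTheory.
Variable F : fieldType.
Implicit Types V W Z : lmodType F.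

Lemma linearD_of V Z (f : V -> Z) : linear f -> {morph f : x y / x + y}.
Proof. by move=> lf x y; have := lf 1 x y; rewrite !scale1r. Qed.

Lemma linear0_of V Z (f : V -> Z) : linear f -> f 0 = 0.
Proof.
by move=> lf; have /eqP := linearD_of lf 0 0;
  rewrite addr0 -subr_eq subrr => /eqP.
Qed.

Lemma linearZ_of V Z (f : V -> Z) c x : linear f -> f (c *: x) = c *: f x.
Proof. by move=> lf; rewrite -[c *: x]addr0 lf linear0_of ?addr0. Qed.

Lemma linearB_of V Z (f : V -> Z) : linear f -> {morph f : x y / x - y}.
Proof.
move=> lf x y.
by rewrite -scaleN1r addrC lf scaleN1r addrC.
Qed.

Lemma linear_sum_of V Z (f : V -> Z) I (r : seq I) (E : I -> V) :
  linear f -> f (\sum_(i <- r) E i) = \sum_(i <- r) f (E i).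
Proof. by move=> lf; apply: big_morph; [apply: linearD_of|apply: linear0_of]. Qed.

Lemma tsum_pi V W Z (s : seq (V * W)) (E : V -> W -> Z) : bilin E ->
  tsum (\pi_(tensor V W) s) E = \sum_(p <- s) E p.1 p.2.
Proof.
move=> [El Er]; rewrite /tsum; have := tensor_reprK s.
move: (repr _) => r; elim=> //= {r s}.
- by move=> s t u _ -> _ ->.
- by move=> s s' t t' _ IHs _ IHt; rewrite !big_cat IHs IHt.
- by move=> s t; rewrite !big_cat /= addrC.
- by move=> v v' w; rewrite !(big_cons, big_nil) /= !addr0 (linearD_of (El w)).
- by move=> v w w'; rewrite !(big_cons, big_nil) /= !addr0 (linearD_of (Er v)).
- move=> c v w; rewrite !(big_cons, big_nil) /= !addr0.
  by rewrite (linearZ_of _ _ (El w)) (linearZ_of _ _ (Er v)).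
- by move=> w; rewrite !(big_cons, big_nil) /= addr0 (linear0_of (El w)).
Qed.

Lemma tsum_pure V W Z (E : V -> W -> Z) v w : bilin E -> tsum (v \ox w) E = E v w.
Proof. by move=> bE; rewrite tsum_pi // big_seq1. Qed.

Lemma tsumP V W Z (E : V -> W -> Z) :
  bilin E -> linear (fun t : tensor V W => tsum t E).
Proof.
move=> bE c; elim/tensor_ind=> s; elim/tensor_ind=> t.
rewrite tensorZE tensorDE !tsum_pi // big_cat; congr (_ + _).
by rewrite big_map scaler_sumr; apply: eq_bigr => p _ /=;
  rewrite (linearZ_of _ _ (bE.1 p.2)).
Qed.

Lemma pure_bilin V W : bilin (@pure F V W).
Proof.
split=> [w|v] c x y; rewrite /pure tensorZE tensorDE;
  apply/tensor_piP => /=.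
- exact: tensor_addl.
- apply: tensor_trans (tensor_addr _ _ _) _; rewrite -cat1s -[[:: _; _]]cat1s.
  apply: tensor_cat (tensor_refl _); apply/tensor_sym; exact: tensor_scale.
Qed.

Lemma tensor_tsum V W (t : tensor V W) : t = \tsum_(x, y <- t) (x \ox y).
Proof.
elim/tensor_ind: t => s; rewrite tsum_pi; last exact: pure_bilin.
elim: s => [|[v w] s IHs]; first by rewrite big_nil.
by rewrite big_cons -IHs /= [_ + _]tensor_addE.
Qed.

Lemma eq_tsum V W Z (t : tensor V W) (E E' : V -> W -> Z) :
  (forall x y, E x y = E' x y) -> tsum t E = tsum t E'.
Proof. by move=> EE; apply: eq_bigr. Qed.

Lemma linear_tsum V W Z Z' (g : Z -> Z') (t : tensor V W) (E : V -> W -> Z) :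
  linear g -> g (tsum t E) = \tsum_(x, y <- t) g (E x y).
Proof. by move=> lg; rewrite /tsum linear_sum_of. Qed.

Lemma tsum_tsum V W V' W' Z (t : tensor V W) (E : V -> W -> tensor V' W')
    (K : V' -> W' -> Z) : bilin K ->
  tsum (tsum t E) K = \tsum_(x, y <- t) tsum (E x y) K.
Proof. by move=> bK; rewrite (linear_tsum _ _ (tsumP bK)). Qed.

Lemma tsum_lin V W Z (t : tensor V W) c (E E1 E2 : V -> W -> Z) :
    (forall x y, E x y = c *: E1 x y + E2 x y) ->
  tsum t E = c *: tsum t E1 + tsum t E2.
Proof.
move=> EE; rewrite /tsum scaler_sumr -big_split.
by apply: eq_bigr => p _; rewrite EE.
Qed.

Lemma exchange_tsum V W V' W' Z (t : tensor V W) (u : tensor V' W')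
    (E : V -> W -> V' -> W' -> Z) :
  \tsum_(x, y <- t) \tsum_(x', y' <- u) E x y x' y' =
  \tsum_(x', y' <- u) \tsum_(x, y <- t) E x y x' y'.
Proof. exact: exchange_big. Qed.

Lemma bilin_comp V W V' W' Z (E : V -> W -> Z)
    (f : V' -> V) (g : W' -> W) :
  linear f -> linear g -> bilin E -> bilin (fun x y => E (f x) (g y)).
Proof. by move=> lf lg [El Er]; split=> u c x y; rewrite ?lf ?lg ?El ?Er. Qed.

Lemma linear_id (V : lmodType F) : linear (fun x : V => x).
Proof. by move=> c x y. Qed.

Lemma linear_comp (V W Z : lmodType F) (f : W -> Z) (g : V -> W) :
  linear f -> linear g -> linear (fun x => f (g x)).
Proof. by move=> lf lg c x y; rewrite lg lf. Qed.

End TensorTheory.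

Section FinDim.
Import VectorInternalTheory.
Variable F : fieldType.
Implicit Types V W : lmodType F.

Definition findim V : Prop :=
  exists (U : vectType F) (f : {linear U -> V}), forall v, exists u, f u = v.

Lemma findim_axiom V : findim V -> {n : nat & Vector.axiom n V}.
Proof.
move=> Vfin; suff /cid[n /cid2[f lf fb]] : exists n,
    exists2 f : V -> 'rV[F]_n, linear f & bijective f by exists n; exists f.
pose P n := exists2 f : 'rV[F]_n -> V, linear f & forall v, exists u, f u = v.
have [n Pn] : exists n, `[< P n >].
  have [U [f fs]] := Vfin; exists (dim U); apply/asboolP.
  exists (f \o r2v) => [c x y|v]; first by rewrite /= !linearP.
  have [u <-] := fs v; exists (v2r u).
  by rewrite /= v2rK.
have /ex_minnP[m /asboolP[f lf fs] mmin] := ex_intro (fun n => `[< P n >]) n Pn.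
have f_inj x : f x = 0 -> x = 0.
  move=> fx0; apply/eqP; apply: contraT => /rV0Pn[i xi].
  case: m => [|m] in f lf fs mmin x fx0 i xi *; first by case: i xi.
  suff /asboolP/mmin : P m by rewrite ltnn.
  exists (fun w => f (\row_j oapp (w 0) 0 (unlift i j))) => [c u v|v].
    rewrite -lf; congr f; apply/rowP=> j; rewrite !mxE.
    by case: unliftP => [k|] _ /=; rewrite ?mxE // mulr0 addr0.
  have [y fy] := fs v; exists (\row_k (y - (y 0 i / x 0 i) *: x) 0 (lift i k)).
  have <- : f (y - (y 0 i / x 0 i) *: x) = v.
    by rewrite (linearB_of lf) (linearZ_of _ _ lf) fx0 scaler0 subr0.
  congr f; apply/rowP=> j; rewrite !mxE.
  by case: unliftP => [k ->|->] /=; rewrite ?mxE // divfK // subrr.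
have [g gK] := choice fs.
have fK : cancel f g.
  move=> x; apply/eqP; rewrite -subr_eq0; apply/eqP/f_inj.
  by rewrite (linearB_of lf) gK subrr.
exists m, g; last by exists f.
by move=> c x y; rewrite -{1}[x]gK -{1}[y]gK -lf fK.
Qed.

(* V with a vectType structure: the coordinates are chosen, the lmodType
   structure is the one of V. *)
Definition vect_of V (Vfin : findim V) : vectType F :=
  let ax := findim_axiom Vfin in
  HB.pack (GRing.Lmodule.sort V) (Lmodule_hasFinDim.Build F V (projT2 ax)).

Lemma findim_vect (U : vectType F) : findim U.
Proof. by exists U, (@idfun U : {linear U -> U}) => v; exists v. Qed.

Lemma findim_surj V W (f : V -> W) :
  linear f -> (forall w, exists v, f v = w) -> findim V -> findim W.
Proof.
move=> lf fs [U [g gs]].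
have lfg : linear (f \o g) by move=> c x y; rewrite /= linearP lf.
pose fgM := GRing.isLinear.Build _ _ _ _ _ lfg.
pose fg : {linear U -> W} := HB.pack (f \o g) fgM.
exists U, fg => w; have [v <-] := fs w; have [u <-] := gs v.
by exists u.
Qed.

Lemma findim_seq V n (e : 'I_n -> V) :
  (forall v, exists c : 'I_n -> F, v = \sum_i c i *: e i) -> findim V.
Proof.
move=> es; apply: findim_surj (findim_vect 'rV[F]_n).
- instantiate (1 := fun u => \sum_i u 0 i *: e i) => c x y.
  rewrite scaler_sumr -big_split; apply: eq_bigr => i _.
  by rewrite !mxE scalerDl scalerA.
- move=> v; have [c ->] := es v; exists (\row_i c i).
  by apply: eq_bigr => i _; rewrite mxE.
Qed.

Lemma findim_tensor V W : findim V -> findim W -> findim (tensor V W).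
Proof.
move=> /findim_axiom[n [f lf [f' fK f'K]]] /findim_axiom[m [g lg [g' gK g'K]]].
have [pl pr] := pure_bilin V W.
have lf' : linear f' by move=> c x y; rewrite -{1}[x]f'K -{1}[y]f'K -lf fK.
have lg' : linear g' by move=> c x y; rewrite -{1}[x]g'K -{1}[y]g'K -lg gK.
pose h (X : 'M[F]_(n, m)) : tensor V W :=
  \sum_i \sum_j X i j *: (f' (delta_mx 0 i) \ox g' (delta_mx 0 j)).
have lh : linear h.
  move=> c X Y; rewrite /h scaler_sumr -big_split; apply: eq_bigr => i _.
  rewrite scaler_sumr -big_split; apply: eq_bigr => j _.
  by rewrite !mxE scalerDl scalerA.
apply: (findim_surj lh) (findim_vect _) => t.
exists (\tsum_(v, w <- t) ((f v)^T *m g w)); rewrite (linear_tsum _ _ lh).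
rewrite [RHS]tensor_tsum; apply: eq_tsum => v w.
rewrite -{2}[v]fK -{2}[w]gK {2}[f v]row_sum_delta {2}[g w]row_sum_delta.
rewrite (linear_sum_of _ _ lf') (linear_sum_of _ _ (pl _)) /h.
apply: eq_bigr => i _; rewrite (linear_sum_of _ _ lg') (linear_sum_of _ _ (pr _)).
apply: eq_bigr => j _; rewrite (linearZ_of _ _ lf') (linearZ_of _ _ lg').
rewrite (linearZ_of _ _ (pl _)) (linearZ_of _ _ (pr _)).
by rewrite scalerA mxE big_ord1 mxE.
Qed.

End FinDim.

Section Quotient.
Variables (F : fieldType) (V : lmodType F) (P : V -> Prop).

(* The linear span of the vectors satisfying P. *)
Definition lspan (x : V) : Prop :=
  exists n (c : 'I_n -> F) (v : 'I_n -> V),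
    (forall i, P (v i)) /\ x = \sum_i c i *: v i.

Lemma lspan_gen x : P x -> lspan x.
Proof.
by exists 1%N, (fun=> 1), (fun=> x); split=> //; rewrite big_ord1 scale1r.
Qed.

Lemma lspan0 : lspan 0.
Proof. by exists 0%N, (fun=> 0), (fun=> 0); split=> [[]//|]; rewrite big_ord0. Qed.

Lemma lspanP a x y : lspan x -> lspan y -> lspan (a *: x + y).
Proof.
move=> [n [c [v [Pv ->]]]] [m [d [w [Pw ->]]]].
exists (n + m)%N, (fun i => match split i with inl j => a * c j | inr j => d j end),
  (fun i => match split i with inl j => v j | inr j => w j end).
split=> [i|]; first by case: split.
rewrite big_split_ord /= scaler_sumr; congr (_ + _); apply: eq_bigr => i _.
  by rewrite (unsplitK (inl i)) scalerA.
by rewrite (unsplitK (inr i)).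
Qed.

Definition lspan_pred : {pred V} := fun x => `[< lspan x >].

Lemma lspan_pred_closed : zmod_closed lspan_pred.
Proof.
split=> [|x y /asboolP Px /asboolP Py]; apply/asboolP; first exact: lspan0.
by rewrite -scaleN1r addrC; apply: lspanP.
Qed.

HB.instance Definition _ := GRing.isZmodClosed.Build V lspan_pred lspan_pred_closed.

(* V / lspan P *)
Definition lquot := Quotient.quot lspan_pred.
HB.instance Definition _ := ZmodQuotient.on lquot.

Lemma lquotP x y : lspan (x - y) <-> \pi_lquot x = \pi_lquot y.
Proof.
split=> [xy|/eqP]; last by rewrite -Quotient.idealrBE => /asboolP.
by apply/eqP; rewrite -Quotient.idealrBE; apply/asboolP.
Qed.

Lemma lquot_repr x : lspan (repr (\pi_lquot x) - x).
Proof. by apply/lquotP; rewrite reprK. Qed.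

Lemma lquot_add x y : \pi_lquot (x + y) = \pi_lquot x + \pi_lquot y.
Proof. by rewrite !piE. Qed.

Definition lquot_scale (c : F) (q : lquot) : lquot := \pi_lquot (c *: repr q).

Lemma lquot_scaleE c x : lquot_scale c (\pi_lquot x) = \pi_lquot (c *: x).
Proof.
apply/lquotP; rewrite -scalerBr -[_ *: _]addr0; apply: lspanP lspan0.
exact: lquot_repr.
Qed.

Lemma lquot_ind (Q : lquot -> Prop) : (forall x, Q (\pi_lquot x)) -> forall q, Q q.
Proof. by move=> Qx q; rewrite -[q]reprK. Qed.

Lemma lquot_scalA c d q : lquot_scale c (lquot_scale d q) = lquot_scale (c * d) q.
Proof. by elim/lquot_ind: q => x; rewrite !lquot_scaleE scalerA. Qed.

Lemma lquot_scal1 : left_id 1 lquot_scale.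
Proof. by elim/lquot_ind=> x; rewrite !lquot_scaleE scale1r. Qed.

Lemma lquot_scalDr : right_distributive lquot_scale +%R.
Proof.
move=> c; elim/lquot_ind=> x; elim/lquot_ind=> y.
by rewrite -lquot_add !lquot_scaleE scalerDr lquot_add.
Qed.

Lemma lquot_scalDl q : {morph lquot_scale^~ q : c d / c + d}.
Proof.
by move=> c d; elim/lquot_ind: q => x; rewrite !lquot_scaleE scalerDl lquot_add.
Qed.

HB.instance Definition _ := GRing.Zmodule_isLmodule.Build F lquot
  lquot_scalA lquot_scal1 lquot_scalDr lquot_scalDl.

Definition lclass (x : V) : lquot := \pi_lquot x.

Lemma lclass_linear : linear lclass.
Proof.
by move=> c x y; rewrite /lclass lquot_add; congr (_ + _); rewrite -lquot_scaleE.
Qed.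

Lemma lclassP x y : lspan (x - y) <-> lclass x = lclass y.
Proof. exact: lquotP. Qed.

Lemma lclass_surj q : exists x, lclass x = q.
Proof. by exists (repr q); apply: reprK. Qed.

Definition llift (Z : Type) (g : V -> Z) (q : lquot) : Z := g (repr q).

Lemma lspan_ker (Z : lmodType F) (g : V -> Z) :
  linear g -> (forall x, P x -> g x = 0) -> forall x, lspan x -> g x = 0.
Proof.
move=> lg g0 _ [n [c [v [Pv ->]]]]; rewrite (linear_sum_of _ _ lg) big1 // => i _.
by rewrite (linearZ_of _ _ lg) g0 // scaler0.
Qed.

Lemma lliftE (Z : lmodType F) (g : V -> Z) :
  linear g -> (forall x, P x -> g x = 0) -> forall x, llift g (lclass x) = g x.
Proof.
move=> lg g0 x; apply/eqP; rewrite -subr_eq0 -(linearB_of lg); apply/eqP.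
exact: lspan_ker lg g0 _ (lquot_repr x).
Qed.

Lemma llift_linear (Z : lmodType F) (g : V -> Z) :
  linear g -> (forall x, P x -> g x = 0) -> linear (llift g).
Proof.
move=> lg g0 c p q; have [x <-] := lclass_surj p; have [y <-] := lclass_surj q.
by rewrite -lclass_linear !lliftE // lg.
Qed.

End Quotient.

Section Category.

Record category := Category {
  Ob :> Type;
  Mor : Ob -> Ob -> Type;
  idm : forall X, Mor X X;
  comp : forall X Y Z, Mor Y Z -> Mor X Y -> Mor X Z;
  comp1m : forall X Y (f : Mor X Y), comp (idm Y) f = f;
  compm1 : forall X Y (f : Mor X Y), comp f (idm X) = f;
  compA : forall X Y Z T (f : Mor Z T) (g : Mor Y Z) (h : Mor X Y),
    comp f (comp g h) = comp (comp f g) h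
}.

Definition is_iso (C : category) (X Y : C) (f : Mor X Y) : Prop :=
  exists g : Mor Y X, comp g f = idm X /\ comp f g = idm Y.

Definition isomorphic (C : category) (X Y : C) : Prop :=
  exists f : Mor X Y, is_iso f.

Record functor (C D : category) := Functor {
  fob :> C -> D;
  fmor : forall X Y : C, Mor X Y -> Mor (fob X) (fob Y);
  fmor1 : forall X, fmor (idm X) = idm (fob X);
  fmorM : forall X Y Z (f : Mor Y Z) (g : Mor X Y),
    fmor (comp f g) = comp (fmor f) (fmor g)
}.

Definition id_functor (C : category) : functor C C :=
  @Functor C C id (fun _ _ f => f) (fun=> erefl) (fun _ _ _ _ _ => erefl).

Lemma comp_fmor1 (C D E : category) (G : functor D E) (K : functor C D) X :
  fmor G (fmor K (idm X)) = idm (G (K X)).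
Proof. by rewrite !fmor1. Qed.

Lemma comp_fmorM (C D E : category) (G : functor D E) (K : functor C D) X Y Z
    (f : Mor Y Z) (g : Mor X Y) :
  fmor G (fmor K (comp f g)) = comp (fmor G (fmor K f)) (fmor G (fmor K g)).
Proof. by rewrite !fmorM. Qed.

Definition comp_functor (C D E : category) (G : functor D E) (K : functor C D) :
    functor C E :=
  @Functor C E (fun X => G (K X)) (fun _ _ f => fmor G (fmor K f))
    (comp_fmor1 G K) (comp_fmorM G K).

Definition natural_iso (C D : category) (G K : functor C D) : Prop :=
  exists eta : forall X, Mor (G X) (K X),
    (forall X Y (f : Mor X Y), comp (eta Y) (fmor G f) = comp (fmor K f) (eta X))
    /\ (forall X, is_iso (eta X)).

Definition equivalence (C D : category) (G : functor C D) : Prop :=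
  exists K : functor D C,
    natural_iso (comp_functor K G) (id_functor C) /\
    natural_iso (comp_functor G K) (id_functor D).

Definition full_subcategory (C : category) (P : C -> Prop) : category :=
  @Category {X : C | P X} (fun X Y => Mor (sval X) (sval Y))
    (fun X => idm (sval X)) (fun _ _ _ f g => comp f g)
    (fun _ _ f => comp1m f) (fun _ _ f => compm1 f)
    (fun _ _ _ _ f g h => compA f g h).

Definition corestrict (C D : category) (P : D -> Prop) (G : functor C D)
    (PG : forall X, P (G X)) : functor C (full_subcategory P) :=
  @Functor C (full_subcategory P) (fun X => exist P (G X) (PG X))
    (fun _ _ f => fmor G f) (fmor1 G) (fun _ _ _ f g => fmorM G f g).

End Category.

Section Rep.
Variables (F : fieldType) (A : algType F).

Record rep := MkRep {
  rep_sort :> vectType F;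
  act : A -> rep_sort -> rep_sort;
  act_linearl : forall m, linear (act^~ m);
  act_linearr : forall a, linear (act a);
  act1 : forall m, act 1 m = m;
  actM : forall a b m, act (a * b) m = act a (act b m)
}.

Record rep_hom (M N : rep) := MkRepHom {
  rep_lfun :> 'Hom(M, N);
  rep_lfun_act : forall a m, rep_lfun (act a m) = act a (rep_lfun m)
}.

Lemma rep_hom_eq (M N : rep) (f g : rep_hom M N) : f =1 g -> f = g.
Proof.
case: f g => [f fa] [g ga] /= fg.
have {}fg : f = g by apply/lfunP.
by case: g / fg ga => ga; congr MkRepHom; apply: Prop_irrelevance.
Qed.

Definition rep_id (M : rep) : rep_hom M M.
Proof. by exists \1%VF => a m; rewrite !id_lfunE. Defined.

Definition rep_comp (M N P : rep) (f : rep_hom N P) (g : rep_hom M N) :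
  rep_hom M P.
Proof. by exists (f \o g)%VF => a m; rewrite !comp_lfunE !rep_lfun_act. Defined.

Lemma rep_comp1m M N (f : rep_hom M N) : rep_comp (rep_id N) f = f.
Proof. by apply: rep_hom_eq => x; rewrite /= comp_lfunE id_lfunE. Qed.

Lemma rep_compm1 M N (f : rep_hom M N) : rep_comp f (rep_id M) = f.
Proof. by apply: rep_hom_eq => x; rewrite /= comp_lfunE id_lfunE. Qed.

Lemma rep_compA M N P Q (f : rep_hom P Q) (g : rep_hom N P) (h : rep_hom M N) :
  rep_comp f (rep_comp g h) = rep_comp (rep_comp f g) h.
Proof. by apply: rep_hom_eq => x; rewrite /= !comp_lfunE. Qed.

Definition Rep : category := Category rep_comp1m rep_compm1 rep_compA.

(* M^{(+) n} *)
Section DirectSum.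
Variables (n : nat) (M : rep).

Definition dsum_act (a : A) (f : {ffun 'I_n -> M}) : {ffun 'I_n -> M} :=
  [ffun i => act a (f i)].

Lemma dsum_linearl f : linear (dsum_act^~ f).
Proof. by move=> c a b; apply/ffunP=> i; rewrite !ffunE act_linearl. Qed.

Lemma dsum_linearr a : linear (dsum_act a).
Proof. by move=> c f g; apply/ffunP=> i; rewrite !ffunE act_linearr. Qed.

Lemma dsum_act1 f : dsum_act 1 f = f.
Proof. by apply/ffunP=> i; rewrite !ffunE act1. Qed.

Lemma dsum_actM a b f : dsum_act (a * b) f = dsum_act a (dsum_act b f).
Proof. by apply/ffunP=> i; rewrite !ffunE actM. Qed.

Definition dsum : rep := MkRep dsum_linearl dsum_linearr dsum_act1 dsum_actM.

End DirectSum.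

Definition simple (M : rep) : Prop :=
  fullv != 0%VS :> {vspace M} /\
  forall U : {vspace M},
    (forall a m, m \in U -> act a m \in U) -> U = 0%VS \/ U = fullv.

End Rep.

Section Restriction.
Variables (F : fieldType) (A B : algType F) (k : {lrmorphism A -> B}).

Lemma restr_linearl (M : rep B) m : linear (fun a => act (k a) m : M).
Proof. by move=> c a b; rewrite linearP act_linearl. Qed.

Lemma restr_linearr (M : rep B) a : linear (fun m : M => act (k a) m).
Proof. exact: act_linearr. Qed.

Lemma restr_act1 (M : rep B) (m : M) : act (k 1) m = m.
Proof. by rewrite rmorph1 act1. Qed.

Lemma restr_actM (M : rep B) a b (m : M) :
  act (k (a * b)) m = act (k a) (act (k b) m).
Proof. by rewrite rmorphM actM. Qed.

Definition restr (M : rep B) : rep A :=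
  MkRep (@restr_linearl M) (@restr_linearr M) (@restr_act1 M) (@restr_actM M).

Definition restr_hom (M N : rep B) (f : rep_hom M N) :
    rep_hom (restr M) (restr N) :=
  @MkRepHom F A (restr M) (restr N) f (fun a m => rep_lfun_act f (k a) m).

Lemma restr_hom1 M : restr_hom (rep_id M) = rep_id (restr M).
Proof. exact: rep_hom_eq. Qed.

Lemma restr_homM M N P (f : rep_hom N P) (g : rep_hom M N) :
  restr_hom (rep_comp f g) = rep_comp (restr_hom f) (restr_hom g).
Proof. exact: rep_hom_eq. Qed.

Definition restriction : functor (Rep B) (Rep A) :=
  @Functor (Rep B) (Rep A) restr restr_hom restr_hom1 restr_homM.

End Restriction.

(* An algType is nonzero; the zero algebra is not connected (its A_t is not
   simple), so nothing is lost. Threefold tensors are bracketed to the right. *)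
Record weakHopf (F : fieldType) := WeakHopf {
  wh_alg :> algType F;
  Delta : {linear wh_alg -> tensor wh_alg wh_alg};
  eps : {scalar wh_alg};
  antipode : {linear wh_alg -> wh_alg};
  Delta_coassoc : forall a,
    \tsum_(x, y <- Delta a) \tsum_(x1, x2 <- Delta x) (x1 \ox (x2 \ox y)) =
    \tsum_(x, y <- Delta a) (x \ox Delta y);
  eps_counitl : forall a, \tsum_(x, y <- Delta a) (eps x *: y) = a;
  eps_counitr : forall a, \tsum_(x, y <- Delta a) (eps y *: x) = a;
  DeltaM : forall a b,
    Delta (a * b) =
    \tsum_(a1, a2 <- Delta a) \tsum_(b1, b2 <- Delta b) ((a1 * b1) \ox (a2 * b2));
  (* (Delta (x) id) Delta(1) = (Delta(1) (x) 1) (1 (x) Delta(1)) *)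
  Delta1l :
    \tsum_(x, y <- Delta 1) \tsum_(x1, x2 <- Delta x) (x1 \ox (x2 \ox y)) =
    \tsum_(x, y <- Delta 1) \tsum_(x', y' <- Delta 1) (x \ox ((y * x') \ox y'));
  (* (Delta (x) id) Delta(1) = (1 (x) Delta(1)) (Delta(1) (x) 1) *)
  Delta1r :
    \tsum_(x, y <- Delta 1) \tsum_(x1, x2 <- Delta x) (x1 \ox (x2 \ox y)) =
    \tsum_(x, y <- Delta 1) \tsum_(x', y' <- Delta 1) (x \ox ((x' * y) \ox y'));
  epsMl : forall a b c,
    eps (a * b * c) = \tsum_(b1, b2 <- Delta b) (eps (a * b1) * eps (b2 * c));
  epsMr : forall a b c,
    eps (a * b * c) = \tsum_(b1, b2 <- Delta b) (eps (a * b2) * eps (b1 * c));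
  antipode_t : forall a,
    \tsum_(a1, a2 <- Delta a) (a1 * antipode a2) =
    \tsum_(x, y <- Delta 1) (eps (x * a) *: y);
  antipode_s : forall a,
    \tsum_(a1, a2 <- Delta a) (antipode a1 * a2) =
    \tsum_(x, y <- Delta 1) (eps (a * y) *: x);
  antipode_conv : forall a,
    \tsum_(x, y <- Delta a) \tsum_(x1, x2 <- Delta x)
      (antipode x1 * x2 * antipode y) = antipode a
}.

Section WeakHopf.
Variables (F : fieldType) (A : weakHopf F).

Definition epst (a : A) : A := \tsum_(a1, a2 <- Delta A a) (a1 * antipode A a2).

Lemma mul_bilin : bilin (fun x y : A => x * y).
Proof.
by split=> u c x y; rewrite ?mulrDl ?mulrDr -?scalerAl -?scalerAr.
Qed.

Lemma epst_linear : linear epst.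
Proof.
apply: linear_comp (tsumP _) (linearP _); apply: bilin_comp mul_bilin.
  exact: linear_id.
exact: linearP.
Qed.

Lemma epstE a : epst a = \tsum_(x, y <- Delta A 1) (eps A (x * a) *: y).
Proof. exact: antipode_t. Qed.

Lemma epstM a b : epst (a * epst b) = epst (a * b).
Proof.
rewrite !epstE; apply: eq_tsum => u v; congr (_ *: _).
rewrite /tsum mulr_sumr mulr_sumr linear_sum.
rewrite -[b in RHS]mul1r !mulrA epsMr /tsum; apply: eq_bigr => p _.
by rewrite -!scalerAr linearZ /= mulrC mulrA.
Qed.

Lemma epst_idem a : epst (epst a) = epst a.
Proof. by rewrite -[epst a in LHS]mul1r epstM mul1r. Qed.

Definition in_At (x : A) : Prop := exists a, x = epst a.

Definition At_pred : {pred A} := fun x => `[< in_At x >].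

Lemma At_pred_closed : submod_closed At_pred.
Proof.
split=> [|c x y /asboolP[a ->] /asboolP[b ->]]; apply/asboolP.
  by exists 0; rewrite (linear0_of epst_linear).
by exists (c *: a + b); rewrite epst_linear.
Qed.

HB.instance Definition _ :=
  GRing.isSubmodClosed.Build F A At_pred (GRing.submod_closed_semi At_pred_closed).

Record At : Type := MkAt { At_val :> A; _ : At_val \in At_pred }.
HB.instance Definition _ := [isSub for At_val].
HB.instance Definition _ := [Choice of At by <:].
HB.instance Definition _ := [SubChoice_isSubLmodule of At by <:].

Lemma epst_in a : epst a \in At_pred.
Proof. by apply/asboolP; exists a. Qed.

(* eps_t, corestricted to its image *)
Definition epsAt (a : A) : At := MkAt (epst_in a).

Lemma At_val_linear : linear At_val.
Proof. exact: (linearP (val : At -> A)). Qed.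

Lemma epst_At (x : At) : epst x = x.
Proof. by case: x => x /= /asboolP[a ->]; rewrite epst_idem. Qed.

Lemma epsAt_linear : linear epsAt.
Proof. by move=> c x y; apply: val_inj; rewrite [RHS]At_val_linear /= epst_linear. Qed.

Lemma epsAtK (x : At) : epsAt x = x.
Proof. by apply: val_inj; rewrite /= epst_At. Qed.

Lemma At_findim : findim At.
Proof.
pose s := repr (Delta A 1).
apply: (@findim_seq _ _ (size s) (fun i => epsAt (nth (0, 0) s i).2)) => x.
exists (fun i => eps A ((nth (0, 0) s i).1 * At_val x)).
rewrite -[LHS]epsAtK -{1}epst_At epstE /tsum (linear_sum_of _ _ epsAt_linear).
rewrite (big_nth (0, 0)) big_mkord; apply: eq_bigr => i _.
by rewrite (linearZ_of _ _ epsAt_linear).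
Qed.

(* The unit object of Rep(A) *)
Definition unit_act (a : A) (x : vect_of At_findim) : vect_of At_findim :=
  epsAt (a * At_val x).

Lemma unit_linearl x : linear (unit_act^~ x).
Proof.
by move=> c a b; rewrite /unit_act mulrDl -scalerAl; exact: epsAt_linear.
Qed.

Lemma unit_linearr a : linear (unit_act a).
Proof.
move=> c x y; rewrite /unit_act.
have -> : At_val (c *: x + y) = c *: At_val x + At_val y := At_val_linear c x y.
rewrite mulrDr -scalerAr.
exact: epsAt_linear.
Qed.

Lemma unit_act1 x : unit_act 1 x = x.
Proof. by rewrite /unit_act mul1r; exact: epsAtK. Qed.

Lemma unit_actM a b x : unit_act (a * b) x = unit_act a (unit_act b x).
Proof. by apply: val_inj; rewrite /= epstM mulrA. Qed.

Definition unit_rep : rep A :=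
  MkRep unit_linearl unit_linearr unit_act1 unit_actM.

(* A conjunction: over a non-closed field A_t can be simple with a larger
   endomorphism field. *)
Definition connected : Prop :=
  [/\ simple unit_rep,
      forall z : A, ((forall a, z * a = a * z) /\ in_At z) <-> exists c, z = c *: 1
    & forall f : rep_hom unit_rep unit_rep, exists c, forall x, f x = c *: x].

Definition Inv (M : rep A) (m : M) : Prop := forall a, act a m = act (epst a) m.

End WeakHopf.

Record is_wh_hom (F : fieldType) (A B : weakHopf F) (k : {lrmorphism A -> B}) :
    Prop := IsWhHom {
  wh_hom_Delta : forall a,
    Delta B (k a) = \tsum_(a1, a2 <- Delta A a) (k a1 \ox k a2);
  wh_hom_eps : forall a, eps B (k a) = eps A a;
  wh_hom_antipode : forall a, antipode B (k a) = k (antipode A a)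
}.

Definition inv_normal (F : fieldType) (A B : weakHopf F)
    (k : {lrmorphism A -> B}) : Prop :=
  forall (M : rep B) (x : M),
    lspan (fun y : M => exists b m, @Inv F A (restr k M) m /\ y = act b m) x <->
    lspan (fun y : M => exists a m, @Inv F A (restr k M) m /\ y = act (k a) m) x.

(* k^*(M) is a multiple of the unit object *)
Definition Ker_obj (F : fieldType) (A B : weakHopf F) (k : {lrmorphism A -> B})
    (M : Rep B) : Prop :=
  exists n, @isomorphic (Rep A) (restriction k M) (dsum n (unit_rep A)).

Definition Ker (F : fieldType) (A B : weakHopf F) (k : {lrmorphism A -> B}) :
    category :=
  full_subcategory (@Ker_obj F A B k).

Record birel_mult (F : fieldType) (B : weakHopf F) (C : algType F) :=
    BirelMult {
  birel_fun :> {linear B -> C};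
  birel_multl : forall a b,
    \tsum_(x, y <- Delta B 1) (birel_fun (a * antipode B x) * birel_fun (y * b)) =
    birel_fun (a * b);
  birel_multr : forall a b,
    \tsum_(x, y <- Delta B 1) (birel_fun (a * x) * birel_fun (antipode B y * b)) =
    birel_fun (a * b)
}.

Definition trivial_on (F : fieldType) (A B : weakHopf F)
    (k : {lrmorphism A -> B}) (C : algType F) (p : birel_mult B C) : Prop :=
  forall a, p (k a) = eps A a *: 1.

(* An algType is nonzero: the zero algebra is omitted from the test objects C,
   where existence and uniqueness of g would be trivial. H itself is nonzero
   since (F, eps B) is a test object. *)
Definition is_cokernel (F : fieldType) (A B : weakHopf F)
    (k : {lrmorphism A -> B}) (H : algType F) (p : birel_mult B H) : Prop :=
  trivial_on k p /\
  forall (C : algType F) (q : birel_mult B C), trivial_on k q ->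
    exists g : {lrmorphism H -> C},
      (forall b, g (p b) = q b) /\
      forall g' : {lrmorphism H -> C}, (forall b, g' (p b) = q b) -> g' =1 g.

Section RelativeRestriction.
Variables (F : fieldType) (B : weakHopf F).

(* S(1_(1)) (x) 1_(2) viewed in B_t (x) B: its image in B (x) B is
   S(1_(1)) (x) 1_(2) by S1tE. *)
Definition S1t : tensor (At B) B :=
  \tsum_(x, y <- Delta B 1) (epsAt x \ox y).

Lemma tsum_S1t (Z : lmodType F) (E : At B -> B -> Z) : bilin E ->
  tsum S1t E = \tsum_(x, y <- Delta B 1) E (epsAt x) y.
Proof.
by move=> bE; rewrite tsum_tsum //; apply: eq_tsum => x y; rewrite tsum_pure.
Qed.

Local Notation epss' a := (\tsum_(x, y <- Delta B 1) (eps B (a * y) *: x)).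

Lemma epss_linear : linear (fun a => epss' a).
Proof.
by move=> c a b; apply: tsum_lin => x y; rewrite mulrDl -scalerAl linearP scalerDl scalerA.
Qed.

Lemma coassoc_apply (Z : lmodType F) (E : B -> B -> B -> Z) a :
    (forall x, bilin (E x)) -> (forall y z, linear (fun x => E x y z)) ->
  \tsum_(x, y <- Delta B a) \tsum_(x1, x2 <- Delta B x) E x1 x2 y =
  \tsum_(x, y <- Delta B a) \tsum_(y1, y2 <- Delta B y) E x y1 y2.
Proof.
move=> Er El.
pose K x (t : tensor B B) := tsum t (E x).
have bK : bilin K.
  split=> [t|x] c u v; last exact: tsumP.
  by apply: tsum_lin => y z; apply: El.
have /(congr1 (fun t => tsum t K)) := Delta_coassoc a.
rewrite !tsum_tsum //; under eq_tsum do rewrite tsum_tsum //.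
under eq_tsum do under eq_tsum do rewrite tsum_pure // /K tsum_pure //.
by move=> ->; apply: eq_tsum => x y; rewrite tsum_pure.
Qed.

Lemma epss_Delta1 (Z : lmodType F) (K : B -> B -> Z) : bilin K ->
  \tsum_(x, y <- Delta B 1) K (epss' x) y = tsum (Delta B 1) K.
Proof.
move=> bK.
pose L x (t : tensor B B) := tsum t (fun y z => eps B y *: K x z).
have bM x : bilin (fun y z => eps B y *: K x z).
  split=> [z|y] c u v; first by rewrite linearP scalerDl scalerA.
  by rewrite bK.2 scalerDr !scalerA mulrC.
have bL : bilin L.
  split=> [t|x] c u v; last exact: tsumP.
  by apply: tsum_lin => y z; rewrite bK.1 scalerDr !scalerA mulrC.
have /(congr1 (fun t => tsum t L)) := Delta1r B.
rewrite !tsum_tsum //.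
under eq_tsum do rewrite tsum_tsum //.
under eq_tsum do under eq_tsum do rewrite tsum_pure // /L tsum_pure //.
under [RHS]eq_tsum do rewrite tsum_tsum //.
under [RHS]eq_tsum do under eq_tsum do rewrite tsum_pure // /L tsum_pure //.
rewrite exchange_tsum => e; transitivity
  (\tsum_(x, y <- Delta B 1) \tsum_(x1, x2 <- Delta B x) (eps B x2 *: K x1 y)).
  rewrite e; apply: eq_tsum => x y; rewrite (linear_tsum _ _ (bK.1 y)).
  apply: eq_tsum => u v; rewrite (linearZ_of _ _ (bK.1 y)).
  by [].
apply: eq_tsum => x y; rewrite -{2}[x](eps_counitr x) (linear_tsum _ _ (bK.1 y)).
by apply: eq_tsum => u v; rewrite (linearZ_of _ _ (bK.1 y)).
Qed.

Lemma antipode_Delta1 (Z : lmodType F) (K : B -> B -> Z) : bilin K ->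
  \tsum_(x, y <- Delta B 1) K (epst x) y =
  \tsum_(x, y <- Delta B 1) K (antipode B x) y.
Proof.
move=> bK; pose E x y z := K (x * antipode B y) z.
have mlin x : linear (fun y : B => x * antipode B y).
  by move=> c u v; rewrite linearP mulrDr -scalerAr.
have mlin' y : linear (fun x : B => x * antipode B y).
  by move=> c u v; rewrite mulrDl -scalerAl.
have bE x : bilin (E x).
  split=> [z|y]; last exact: bK.2.
  exact: linear_comp (bK.1 z) (mlin x).
have lE y z : linear (fun x => E x y z).
  exact: linear_comp (bK.1 z) (mlin' y).
transitivity (\tsum_(x, y <- Delta B 1) \tsum_(x1, x2 <- Delta B x) E x1 x2 y).
  by apply: eq_tsum => x y; rewrite (linear_tsum _ _ (bK.1 y)).
rewrite coassoc_apply //.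
pose G x y := \tsum_(y1, y2 <- Delta B y) E x y1 y2.
have bG : bilin G.
  split=> [y|x]; first by move=> c u v; apply: tsum_lin => *; apply: lE.
  exact: linear_comp (tsumP (bE x)) (linearP _).
rewrite -[LHS](epss_Delta1 bG) /G -(coassoc_apply (E := fun x => E (epss' x))) //.
  apply: eq_tsum => x y; rewrite -[in RHS](antipode_conv x).
  rewrite (linear_tsum _ _ (bK.1 y)); apply: eq_tsum => u v.
  rewrite (linear_tsum _ _ (bK.1 y)) -antipode_s /E.
  by rewrite (linear_tsum _ _ (linear_comp (bK.1 y) (mlin' v))).
by move=> y z; apply: linear_comp (lE y z) epss_linear.
Qed.

Lemma S1tE :
  \tsum_(x, y <- S1t) (At_val x \ox y) =
  \tsum_(x, y <- Delta B 1) (antipode B x \ox y).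
Proof.
rewrite tsum_S1t; last first.
  exact: bilin_comp (@At_val_linear _ B) (@linear_id _ _) (pure_bilin _ _).
exact: antipode_Delta1 (pure_bilin _ _).
Qed.

Lemma tsum_S1t_val (Z : lmodType F) (E : B -> B -> Z) : bilin E ->
  \tsum_(x, y <- S1t) E (At_val x) y =
  \tsum_(x, y <- Delta B 1) E (antipode B x) y.
Proof.
move=> bE; have tE (V W : lmodType F) (t : tensor V W) (f : V -> B) (g : W -> B) :
    \tsum_(x, y <- t) E (f x) (g y) = tsum (\tsum_(x, y <- t) (f x \ox g y)) E.
  by rewrite tsum_tsum //; apply: eq_tsum => x y; rewrite tsum_pure.
transitivity (tsum (\tsum_(x, y <- S1t) (At_val x \ox y)) E).
  exact: (tE _ _ S1t (@At_val F B) id).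
rewrite S1tE; apply/esym; exact: (tE _ _ (Delta B 1) (antipode B) id).
Qed.

Section Object.
Variables (H : algType F) (p : birel_mult B H) (M : rep H).

(* pi^*(M) = B_t (x) M / lspan rr_rel, with rr_box x m the class of x (x) m;
   the action is given on classes by rr_actE. *)
Definition rr_rel (t : tensor (At B) M) : Prop :=
  exists x m,
    t = x \ox m - \tsum_(s, y <- S1t) (s \ox act (p (y * At_val x)) m).

Definition rr_quot : lmodType F := lquot rr_rel.

Definition rr_box (x : At B) (m : M) : rr_quot := lclass rr_rel (x \ox m).

Definition rr_act (b : B) : rr_quot -> rr_quot :=
  llift (fun t => \tsum_(x, m <- t)
    \tsum_(s, y <- S1t) rr_box s (act (p (y * b * At_val x)) m)).

Lemma rr_findim : findim rr_quot.
Proof.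
apply: findim_surj (findim_tensor (At_findim B) (findim_vect M)).
  exact: (lclass_linear rr_rel).
exact: lclass_surj.
Qed.

Lemma rr_box_bilin : bilin rr_box.
Proof.
have [pl pr] := pure_bilin (At B) M.
split=> [m|x].
  exact: linear_comp (lclass_linear rr_rel) (pl m).
exact: linear_comp (lclass_linear rr_rel) (pr x).
Qed.

Let actp_linear (m : M) : linear (fun b => act (p b) m).
Proof. exact: linear_comp (act_linearl m) (linearP p). Qed.

Let box_inner_bilin b (x : At B) (m : M) :
  bilin (fun s y => rr_box s (act (p (y * b * At_val x)) m)).
Proof.
apply: (bilin_comp (@linear_id _ _)) rr_box_bilin.
apply: linear_comp (actp_linear m) _ => c u v.
by rewrite !mulrDl -!scalerAl.
Qed.

Let rr_pre b (x : At B) (m : M) :=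
  \tsum_(s, y <- S1t) rr_box s (act (p (y * b * At_val x)) m).

Lemma rr_pre_bilin b : bilin (rr_pre b).
Proof.
split=> [m|x] c u v; apply: tsum_lin => s y.
  rewrite [At_val _]At_val_linear mulrDr -scalerAr (actp_linear m).
  exact: rr_box_bilin.2.
by rewrite act_linearr rr_box_bilin.2.
Qed.

Lemma rr_pre_comp b b' x m :
  \tsum_(s, y <- S1t) rr_pre b s (act (p (y * b' * At_val x)) m) =
  rr_pre (b * b') x m.
Proof.
rewrite /rr_pre exchange_tsum; apply: eq_tsum => s y.
rewrite -(linear_tsum _ _ (rr_box_bilin.2 s)); congr rr_box.
under eq_tsum do rewrite -actM.
rewrite -(linear_tsum _ _ (act_linearl m)); congr act.
rewrite !mulrA -[in RHS]mulrA -birel_multl.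
under eq_tsum do rewrite -[_ * b' * _]mulrA.
apply: (tsum_S1t_val (E := fun u v => p (y * b * u) * p (v * (b' * At_val x)))).
by split=> [v|u] c r t;
  rewrite ?mulrDr ?mulrDl -?scalerAr -?scalerAl linearP ?mulrDr ?mulrDl
    -?scalerAr -?scalerAl.
Qed.

Lemma rr_pre_rel b t : rr_rel t -> tsum t (rr_pre b) = 0.
Proof.
move=> [x [m ->]]; have bE := rr_pre_bilin b.
rewrite (linearB_of (tsumP bE)) tsum_tsum // tsum_pure //.
under [X in _ - X]eq_tsum do rewrite tsum_pure //.
rewrite -[in X in X - _](mulr1 b) -(rr_pre_comp b 1).
by apply/eqP; rewrite subr_eq0; apply/eqP/eq_tsum => s y; rewrite mulr1.
Qed.

Lemma rr_actE b x m :
  rr_act b (rr_box x m) =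
  \tsum_(s, y <- S1t) rr_box s (act (p (y * b * At_val x)) m).
Proof.
rewrite /rr_act /rr_box lliftE ?tsum_pure //; first exact: rr_pre_bilin.
  exact: tsumP (rr_pre_bilin b).
exact: rr_pre_rel.
Qed.

Lemma rr_boxE x m :
  rr_box x m = \tsum_(s, y <- S1t) rr_box s (act (p (y * At_val x)) m).
Proof.
rewrite -(linear_tsum _ _ (lclass_linear rr_rel)); apply/lclassP/lspan_gen.
by exists x, m.
Qed.

Lemma rr_act_linearr b : linear (rr_act b).
Proof. by apply: llift_linear (tsumP (rr_pre_bilin b)) (rr_pre_rel b). Qed.

Lemma rr_ind (Z : lmodType F) (f g : rr_quot -> Z) :
  linear f -> linear g -> (forall x m, f (rr_box x m) = g (rr_box x m)) -> f =1 g.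
Proof.
move=> lf lg fg q; have [t <-] := lclass_surj q; rewrite [t]tensor_tsum.
rewrite (linear_tsum _ _ (lclass_linear rr_rel)).
by rewrite (linear_tsum _ _ lf) (linear_tsum _ _ lg); apply: eq_tsum.
Qed.

Lemma rr_act_linearl q : linear (rr_act^~ q).
Proof.
move=> c a b /=.
have lin2 : linear (fun q => c *: rr_act a q + rr_act b q).
  move=> d u v; rewrite !rr_act_linearr !scalerDr !scalerA mulrC.
  by rewrite addrACA.
apply: (rr_ind (rr_act_linearr _) lin2) => x m; rewrite !rr_actE.
apply: tsum_lin => s y; rewrite mulrDr mulrDl -scalerAr -scalerAl.
by rewrite actp_linear rr_box_bilin.2.
Qed.

Lemma rr_act1 q : rr_act 1 q = q.
Proof.
apply: (rr_ind (rr_act_linearr 1) (@linear_id _ _)) => x m.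
by rewrite rr_actE [RHS]rr_boxE; apply: eq_tsum => s y; rewrite mulr1.
Qed.

Lemma rr_actM a b q : rr_act (a * b) q = rr_act a (rr_act b q).
Proof.
apply: (rr_ind (rr_act_linearr _)
  (linear_comp (rr_act_linearr a) (rr_act_linearr b))) => x m.
rewrite !rr_actE (linear_tsum _ _ (rr_act_linearr a)) -[LHS]rr_pre_comp.
by apply: eq_tsum => s y; rewrite rr_actE.
Qed.

Definition rr_rep : rep B :=
  @MkRep F B (vect_of rr_findim) rr_act rr_act_linearl rr_act_linearr
    rr_act1 rr_actM.

End Object.

Section Morphism.
Variables (H : algType F) (p : birel_mult B H) (M N : rep H) (f : rep_hom M N).

Definition rr_map : rr_quot p M -> rr_quot p N :=
  llift (fun t => \tsum_(x, m <- t) rr_box p x (f m)).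

Lemma rr_map_bilin : bilin (fun x m => rr_box p x (f m)).
Proof. exact: bilin_comp (@linear_id _ _) (linearP f) (rr_box_bilin p N). Qed.

Lemma rr_map_rel t : rr_rel p t -> \tsum_(x, m <- t) rr_box p x (f m) = 0.
Proof.
move=> [x [m ->]]; rewrite (linearB_of (tsumP rr_map_bilin)).
rewrite tsum_tsum ?tsum_pure //; try exact: rr_map_bilin.
apply/eqP; rewrite subr_eq0; apply/eqP; rewrite rr_boxE.
apply: eq_tsum => s y; rewrite tsum_pure ?rep_lfun_act //.
exact: rr_map_bilin.
Qed.

Lemma rr_map_linear : linear rr_map.
Proof. exact: llift_linear (tsumP rr_map_bilin) rr_map_rel. Qed.

Lemma rr_mapE x m : rr_map (rr_box p x m) = rr_box p x (f m).
Proof.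
rewrite /rr_map /rr_box lliftE ?tsum_pure //; first exact: rr_map_bilin.
  exact: tsumP rr_map_bilin.
exact: rr_map_rel.
Qed.

HB.instance Definition _ :=
  GRing.isLinear.Build F (rr_rep p M) (rr_rep p N) _
    (rr_map : rr_rep p M -> rr_rep p N) rr_map_linear.

Definition rr_lfun : 'Hom(rr_rep p M, rr_rep p N) :=
  linfun (rr_map : rr_rep p M -> rr_rep p N).

Lemma rr_lfunE q : rr_lfun q = rr_map q.
Proof. exact: lfunE. Qed.

Lemma rr_lfun_act b q : rr_lfun (act b q) = act b (rr_lfun q).
Proof.
rewrite !rr_lfunE; suff e : (fun q => rr_map (rr_act b q)) =1
  (fun q => rr_act b (rr_map q)) by exact: e.
apply: rr_ind => [||x m].
- exact: linear_comp rr_map_linear (rr_act_linearr b).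
- exact: linear_comp (rr_act_linearr b) rr_map_linear.
rewrite rr_mapE !rr_actE (linear_tsum _ _ rr_map_linear).
by apply: eq_tsum => s y; rewrite rr_mapE rep_lfun_act.
Qed.

Definition rr_hom : rep_hom (rr_rep p M) (rr_rep p N) := MkRepHom rr_lfun_act.

End Morphism.

Section Functor.
Variables (H : algType F) (p : birel_mult B H).

Lemma rr_hom1 (M : rep H) : rr_hom p (rep_id M) = rep_id (rr_rep p M).
Proof.
apply: rep_hom_eq => q; rewrite /= rr_lfunE id_lfunE.
suff e : rr_map (p := p) (rep_id M) =1 id by exact: e.
apply: rr_ind => [||x m]; [exact: rr_map_linear|exact: linear_id|].
by rewrite rr_mapE /= id_lfunE.
Qed.

Lemma rr_homM (M N P : rep H) (f : rep_hom N P) (g : rep_hom M N) :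
  rr_hom p (rep_comp f g) = rep_comp (rr_hom p f) (rr_hom p g).
Proof.
apply: rep_hom_eq => q; rewrite /= comp_lfunE !rr_lfunE.
suff e : rr_map (p := p) (rep_comp f g) =1
    (fun q => rr_map (p := p) f (rr_map g q)).
  exact: e.
apply: rr_ind => [||x m]; first exact: rr_map_linear.
  exact: linear_comp (rr_map_linear f) (rr_map_linear g).
by rewrite !rr_mapE /= comp_lfunE.
Qed.

Definition rel_restriction : functor (Rep H) (Rep B) :=
  @Functor (Rep H) (Rep B) (rr_rep p) (@rr_hom H p) rr_hom1 rr_homM.

End Functor.

End RelativeRestriction.

(* Main.v *)
From HB Require Import structures.
Require Import Defs.
From mathcomp Require Import all_boot all_algebra.
From mathcomp Require Import boolp.

(** Write Ker for the B-modules V whose restriction to A is a multiple A_t (x) W of the unit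
    object. On such a V there are a map u : W -> V, w |-> 1 (x) w, and a map e : V -> W,
    x (x) w |-> eps(x) w, with e(k(a).u(w)) = eps(a) w. The legs of eps_t(1_(1)) (x) 1_(2) are
    dual bases of A_t for the counit pairing ([epst_eps_Delta1]), and therefore every v is
    recovered as S(1_(1)).u(e(1_(2).v)), where Delta(1) may be taken in A or in B because k
    preserves it. A pair (u, e) with these two properties is called a framing; the modules with
    a framing are exactly the multiples of A_t ([framing_iso], [dsum_framing]).

    The reconstruction formula carries the correspondence with H-modules both ways. Given an
    H-module M, the maps m |-> 1 (x) m and x (x) m |-> pi(x) m frame the relative restriction
    ([rr_framing]), by the first birelative identity of pi; so pi^* lands in Ker. Given V framed
    by W, the operators T(b) = e(b.u(-)) on W satisfy
      T(a S(1_(1))) T(1_(2) b) = T(ab) = T(a 1_(1)) T(S(1_(2)) b)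
    because the inner part of each side is a reconstruction of b.u(-), and T(k(a)) = eps(a). By
    the universal property T factors through H, W becomes an H-module, and x (x) w |-> x.u(w)
    identifies its relative restriction with V ([framing_rep_iso]): pi^* is essentially
    surjective onto Ker.

    A morphism between relative restrictions is A-linear and maps invariants to invariants.
    When A_t has only scalar endomorphisms, the invariants of A_t (x) W are the 1 (x) w
    ([fr_Inv]), so the morphism is id (x) g for a unique linear g ([framing_hom]). This g
    commutes with every pi(b), hence with H, which is generated by pi(B)
    ([coker_generated]). So pi^* is fully faithful. *)

Set Implicit Arguments.
Unset Strict Implicit.
Unset Printing Implicit Defensive.

Import GRing.Theory.

Local Open Scope ring_scope.

(** * Linearity side conditions *)

Section Linearity.
Variable F : fieldType.
Implicit Types V W Z : lmodType F.

Lemma bilin_scale V W Z (f : V -> F) (g : W -> Z) :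
  scalar f -> linear g -> bilin (fun x y => f x *: g y).
Proof.
move=> lf lg; split=> [w|v] c x y; first by rewrite lf scalerDl scalerA.
by rewrite lg scalerDr !scalerA mulrC.
Qed.

Lemma bilinC V W Z (E : V -> W -> Z) :
  bilin E -> bilin (fun y x => E x y).
Proof. by case. Qed.

Lemma bilin_lin V W Z Z' (g : Z -> Z') (E : V -> W -> Z) :
  linear g -> bilin E -> bilin (fun x y => g (E x y)).
Proof. by move=> lg [El Er]; split=> w c x y; rewrite ?El ?Er lg. Qed.

Lemma scalar_comp V W (f : W -> F) (g : V -> W) :
  scalar f -> linear g -> scalar (fun x => f (g x)).
Proof. by move=> lf lg c x y; rewrite lg lf. Qed.

Lemma scalar_tsum V W Z (g : Z -> F) (t : tensor V W) (E : V -> W -> Z) :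
  scalar g -> g (tsum t E) = \tsum_(x, y <- t) g (E x y).
Proof. exact: (@linear_tsum F V W Z F^o g t E). Qed.

End Linearity.

(** * Dual bases of the base algebras *)

Section WeakHopfFacts.
Variables (F : fieldType) (A : weakHopf F).
Implicit Types a b : A.

(** The source counital map, equal to S(a_(1)) a_(2) by [antipode_s]. *)
Definition epss a : A := \tsum_(x, y <- Delta A 1) (eps A (a * y) *: x).

Lemma mull_linear (R : algType F) (a : R) : linear (fun x : R => x * a).
Proof. by move=> c x y; rewrite mulrDl -scalerAl. Qed.

Lemma mulr_linear (R : algType F) (a : R) : linear (fun x : R => a * x).
Proof. by move=> c x y; rewrite mulrDr -scalerAr. Qed.

Lemma epsl_scalar a : scalar (fun x : A => eps A (x * a)).
Proof. exact: scalar_comp (linearP _) (mull_linear a). Qed.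

Lemma eps_epst a : eps A (epst a) = eps A a.
Proof.
rewrite epstE (scalar_tsum _ _ (linearP (eps A))).
rewrite -[in RHS](mul1r a) -{2}(eps_counitr (1 : A)).
rewrite (scalar_tsum _ _ (epsl_scalar a)).
by apply: eq_bigr => p _; rewrite linearZ -scalerAl linearZ /= mulrC.
Qed.

Lemma eps_epss a b : eps A (epss a * b) = eps A (a * b).
Proof.
rewrite (scalar_tsum _ _ (epsl_scalar b)) -[a in RHS]mulr1 epsMr.
by apply: eq_bigr => p _; rewrite -scalerAl linearZ.
Qed.

(** The legs of eps_t(1_(1)) (x) 1_(2) are dual bases of A_t for the bilinear form
    eps(y x). Expanding eps_t, the sum becomes eps(1'_(1) 1_(1)) eps(1_(2) a) 1'_(2), which
    weak multiplicativity of the counit contracts to eps(1'_(1) a) 1'_(2). *)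
Lemma epst_eps_Delta1 a : \tsum_(x, y <- Delta A 1) (eps A (y * a) *: epst x) = epst a.
Proof.
rewrite epstE.
under eq_tsum => x y do rewrite epstE scaler_sumr.
rewrite /tsum exchange_big; apply: eq_bigr => p _ /=.
rewrite -[p.1 in RHS]mulr1 epsMl /tsum scaler_suml; apply: eq_bigr => q _.
by rewrite scalerA mulrC.
Qed.

(** Apply id (x) eps (x) id to the two expressions of (Delta (x) id) Delta(1): the counit
    axiom leaves Delta(1), the product formula leaves 1_(1) (x) eps_t(1_(2)). *)
Lemma epst_Delta1r (Z : lmodType F) (K : A -> A -> Z) : bilin K ->
  \tsum_(x, y <- Delta A 1) K x (epst y) = tsum (Delta A 1) K.
Proof.
move=> bK.
pose L x (t : tensor A A) := tsum t (fun y z => eps A y *: K x z).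
have bM x : bilin (fun y z => eps A y *: K x z).
  exact: bilin_scale (linearP _) (bK.2 x).
have bL : bilin L.
  split=> [t|x] c u v; last exact: tsumP.
  by apply: tsum_lin => y z; rewrite bK.1 scalerDr !scalerA mulrC.
have /(congr1 (fun t => tsum t L)) := Delta1r A.
rewrite !tsum_tsum //.
under eq_tsum do rewrite tsum_tsum //.
under eq_tsum do under eq_tsum do rewrite tsum_pure // /L tsum_pure //.
under [RHS]eq_tsum do rewrite tsum_tsum //.
under [RHS]eq_tsum do under eq_tsum do rewrite tsum_pure // /L tsum_pure //.
move=> e; transitivity
  (\tsum_(x, y <- Delta A 1) \tsum_(x1, x2 <- Delta A x) (eps A x2 *: K x1 y)).
  rewrite e; apply: eq_tsum => x y; rewrite epstE (linear_tsum _ _ (bK.2 x)).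
  by apply: eq_tsum => u v; rewrite (linearZ_of _ _ (bK.2 x)).
apply: eq_tsum => x y; rewrite -{2}[x](eps_counitr x) (linear_tsum _ _ (bK.1 y)).
by apply: eq_tsum => u v; rewrite (linearZ_of _ _ (bK.1 y)).
Qed.

(** On A_t, where the second leg of Delta(1) lies, S and eps_s coincide. Inserting eps_t in
    the last leg of 1_(1) (x) S(1_(2)) 1_(3) gives 1_(1) (x) S(1_(2)) 1_(3) S(1_(4)), which
    is 1_(1) (x) S(1_(2)) by the convolution identity S * id * S = S. *)
Lemma antipode_Delta1r (Z : lmodType F) (K : A -> A -> Z) : bilin K ->
  \tsum_(x, y <- Delta A 1) K x (epss y) =
  \tsum_(x, y <- Delta A 1) K x (antipode A y).
Proof.
move=> bK; pose E x y z := K x (antipode A y * z).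
have lS : linear (antipode A) by exact: linearP.
have bSm : bilin (fun y z : A => antipode A y * z).
  exact: (bilin_comp lS (@linear_id _ _)) (@mul_bilin F A).
have bE x : bilin (E x) by apply: bilin_lin (bK.2 x) bSm.
have lE y z : linear (fun x => E x y z) by apply: bK.1.
transitivity (\tsum_(x, y <- Delta A 1) \tsum_(y1, y2 <- Delta A y) E x y1 y2).
  apply: eq_tsum => x y; rewrite /epss -antipode_s.
  by rewrite (linear_tsum _ _ (bK.2 x)).
rewrite -coassoc_apply //.
pose G x y := \tsum_(x1, x2 <- Delta A x) E x1 x2 y.
have bG : bilin G.
  split=> [y|x].
    apply: (@linear_comp _ _ _ _ (fun t => \tsum_(x1, x2 <- t) E x1 x2 y) (Delta A)).
      by apply: tsumP; split=> [z|x]; [apply: lE|apply: (bE x).1].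
    exact: linearP.
  by move=> c u v; apply: tsum_lin => *; apply: (bE _).2.
rewrite -[LHS](epst_Delta1r bG) /G (coassoc_apply (E := fun x y z => E x y (epst z))).
- apply: eq_tsum => x y; rewrite -[in RHS](antipode_conv y).
  rewrite (linear_tsum _ _ (bK.2 x)).
  under [RHS]eq_tsum => u v do rewrite (linear_tsum _ _ (bK.2 x)).
  rewrite (coassoc_apply (E := fun u v w => K x (antipode A u * v * antipode A w))).
  - apply: eq_tsum => u v; rewrite /E /epst mulr_sumr (linear_sum_of _ _ (bK.2 x)).
    by apply: eq_bigr => p _; rewrite mulrA.
  - move=> u; apply: (bilin_lin (bK.2 x)).
    apply: (bilin_comp (mulr_linear (antipode A u)) lS) (@mul_bilin F A).
  - move=> u v; apply: (linear_comp (bK.2 x)).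
    exact: linear_comp (mull_linear _) (linear_comp (mull_linear _) lS).
- by move=> x; apply: (bilin_comp (@linear_id _ _) (@epst_linear F A)).
- by move=> y z; apply: lE.
Qed.

(** The antipode may be inserted in [epst_eps_Delta1], because eps_s is invisible to the
    counit on the left of a product. *)
Lemma epst_eps_antipode_Delta1 a :
  \tsum_(x, y <- Delta A 1) (eps A (antipode A y * a) *: epst x) = epst a.
Proof.
rewrite -[RHS]epst_eps_Delta1.
rewrite -(antipode_Delta1r (K := fun x y => eps A (y * a) *: epst x)).
  by apply: eq_tsum => x y; rewrite eps_epss.
by apply: bilinC; apply: bilin_scale (epsl_scalar a) (@epst_linear F A).
Qed.

(** Normalising an element of nonzero counit matters: eps(1) itself may vanish in positive
    characteristic. *)
Lemma eps_eq1 : exists a, eps A a = 1.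
Proof.
have [[a ea]|e0] := pselect (exists a, eps A a != 0).
  by exists ((eps A a)^-1 *: a); rewrite linearZ /= mulVf.
suff /eqP : (1 : A) = 0 by rewrite oner_eq0.
rewrite -(eps_counitl (1 : A)) /tsum big1 // => p _.
have [->|ea] := eqVneq (eps A p.1) 0; first by rewrite scale0r.
by case: e0; exists p.1.
Qed.
End WeakHopfFacts.

(** * Morphisms of representations from bare maps *)

Section RepHom.
Variables (F : fieldType) (R : algType F).
Implicit Types M N : rep R.

Lemma rep_hom_exists M N (f : M -> N) : linear f ->
    (forall a m, f (act a m) = act a (f m)) ->
  exists g : rep_hom M N, g =1 f.
Proof.
move=> lf fa.
pose fL : {linear M -> N} := HB.pack f (GRing.isLinear.Build F M N _ f lf).
have fE : linfun fL =1 f by move=> x; rewrite lfunE.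
have ga a m : linfun fL (act a m) = act a (linfun fL m) by rewrite !fE fa.
by exists (MkRepHom ga).
Qed.

Lemma rep_iso_inv M N (f : rep_hom M N) (g : N -> M) : cancel f g -> cancel g f ->
  exists h : rep_hom N M,
    h =1 g /\ rep_comp h f = rep_id M /\ rep_comp f h = rep_id N.
Proof.
move=> fK gK.
have lg : linear g.
  move=> c x y; apply: (can_inj fK); have -> := gK (c *: x + y).
  by rewrite linearP; congr (_ *: _ + _); apply/esym/gK.
have ga a m : g (act a m) = act a (g m).
  by apply: (can_inj fK); rewrite rep_lfun_act; have -> := gK (act a m); rewrite gK.
have [h hE] := rep_hom_exists lg ga; exists h; split=> //.
by split; apply: rep_hom_eq => x /=; rewrite comp_lfunE id_lfunE hE ?fK ?gK.
Qed.

Lemma rep_isoP M N (f : rep_hom M N) (g : N -> M) : cancel f g -> cancel g f ->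
  @is_iso (Rep R) M N f.
Proof. by move=> fK gK; have [h [_ ?]] := rep_iso_inv fK gK; exists h. Qed.

End RepHom.

(** * Framed modules: multiples of the unit object *)

Section UnitRep.
Variables (F : fieldType) (A : weakHopf F).

Lemma epst1 : epst (1 : A) = 1.
Proof. by rewrite epstE; under eq_tsum do rewrite mulr1; rewrite eps_counitl. Qed.

Definition unit_one : unit_rep A := epsAt (1 : A).

Lemma unit_oneE : At_val unit_one = 1.
Proof. exact: epst1. Qed.

Lemma act_unit_one a : act a unit_one = epsAt a.
Proof. by rewrite -[a in RHS]mulr1 -unit_oneE. Qed.

End UnitRep.

Section Framing.
Variables (F : fieldType) (A : weakHopf F).

(** A framing presents X as A_t (x) W without choosing a basis of W: fr_in is
    w |-> 1 (x) w and fr_out is x (x) w |-> eps(x) w. The last field says that the dual bases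
    eps_t(1_(1)), 1_(2) of A_t reconstruct a vector from the values of fr_out; it replaces the
    condition that X be generated by the image of fr_in. *)
Record framing (X : rep A) (W : vectType F) := Framing {
  fr_in : W -> X;
  fr_out : X -> W;
  fr_in_linear : linear fr_in;
  fr_out_linear : linear fr_out;
  fr_outK : forall a w, fr_out (act a (fr_in w)) = eps A a *: w;
  fr_span : forall v,
    \tsum_(x, y <- Delta A 1) act (epst x) (fr_in (fr_out (act y v))) = v
}.

Section Theory.
Variables (X : rep A) (W : vectType F) (fr : framing X W).
Local Notation u := (fr_in fr).
Local Notation e := (fr_out fr).

(** In A_t (x) W the vectors 1 (x) w are invariant; in terms of the two framing identities,
    reconstruct a.u(w) and contract with [epst_eps_Delta1]. *)
Lemma fr_inv w : Inv (u w).
Proof.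
move=> a; rewrite -[LHS](fr_span fr) -epst_eps_Delta1.
rewrite (linear_tsum _ _ (act_linearl (u w))); apply: eq_tsum => x y.
rewrite -actM fr_outK (linearZ_of _ _ (fr_in_linear fr)).
by rewrite (linearZ_of _ _ (act_linearr _)) -(linearZ_of _ _ (act_linearl _)).
Qed.

(** By [fr_span], X is spanned by the a.u(w). *)
Lemma fr_ind (Z : lmodType F) (f g : X -> Z) : linear f -> linear g ->
  (forall a w, f (act a (u w)) = g (act a (u w))) -> f =1 g.
Proof.
move=> lf lg fg v; rewrite -(fr_span fr v) (linear_tsum _ _ lf) (linear_tsum _ _ lg).
exact: eq_tsum.
Qed.

(** The variant of [fr_span] with the antipode on the second leg: this is what the second
    birelative identity asks of the maps b |-> e(b.u(-)). *)
Lemma fr_span_antipode v :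
  \tsum_(x, y <- Delta A 1) act x (u (e (act (antipode A y) v))) = v.
Proof.
move: v; apply: fr_ind => [c v v'||a w].
- apply: tsum_lin => x y.
  by rewrite act_linearr (fr_out_linear fr) (fr_in_linear fr) act_linearr.
- exact: linear_id.
rewrite [RHS]fr_inv -epst_eps_antipode_Delta1.
rewrite (linear_tsum _ _ (act_linearl (u w))); apply: eq_tsum => x y.
rewrite -actM fr_outK (linearZ_of _ _ (fr_in_linear fr)).
by rewrite (linearZ_of _ _ (act_linearr _)) fr_inv -(linearZ_of _ _ (act_linearl _)).
Qed.

(** Acting by an element of counit 1 makes fr_out a retraction. *)
Lemma fr_in_inj : injective u.
Proof.
have [a ea] := eps_eq1 A => w w' uw.
by rewrite -[w]scale1r -ea -(fr_outK fr) uw fr_outK ea scale1r.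
Qed.

Lemma fr_basis_sum (w : W) (b := vbasis (fullv : {vspace W})) :
  w = \sum_i coord b i w *: tnth b i.
Proof.
rewrite {1}(coord_vbasis (memvf w)); apply: eq_bigr => i _.
by rewrite (tnth_nth 0).
Qed.

Lemma coord_basis i j (b := vbasis (fullv : {vspace W})) :
  coord b i (tnth b j) = (i == j)%:R.
Proof. by rewrite (tnth_nth 0) coord_free ?(basis_free (vbasisP _)) // eq_sym. Qed.

Let n := \dim (fullv : {vspace W}).
Let b := vbasis (fullv : {vspace W}).

Definition fr_of_dsum (f : dsum n (unit_rep A)) : X :=
  \sum_i act (At_val (f i)) (u (tnth b i)).

Definition fr_coord i (v : X) : At A :=
  \tsum_(x, y <- Delta A 1) (coord b i (e (act y v)) *: epsAt x).

Definition fr_to_dsum (v : X) : dsum n (unit_rep A) := [ffun i => fr_coord i v].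

Lemma fr_coordE i v : At_val (fr_coord i v) =
  \tsum_(x, y <- Delta A 1) (coord b i (e (act y v)) *: epst x).
Proof.
rewrite (linear_tsum _ _ (@At_val_linear F A)); apply: eq_tsum => x y.
exact: linearZ_of (@At_val_linear F A).
Qed.

Lemma fr_of_dsum_linear : linear fr_of_dsum.
Proof.
move=> c f g; rewrite /fr_of_dsum scaler_sumr -big_split; apply: eq_bigr => i _.
by rewrite !ffunE /= -act_linearl.
Qed.

Lemma fr_of_dsum_act a f : fr_of_dsum (act a f) = act a (fr_of_dsum f).
Proof.
rewrite /fr_of_dsum (linear_sum_of _ _ (act_linearr a)); apply: eq_bigr => i _.
by rewrite ffunE /= -fr_inv actM.
Qed.

Lemma fr_of_dsumK : cancel fr_of_dsum fr_to_dsum.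
Proof.
move=> f; apply/ffunP=> i; rewrite ffunE; apply: val_inj.
rewrite -[LHS]/(At_val _) fr_coordE -[RHS]epst_At -[RHS]epst_eps_Delta1.
apply: eq_tsum => x y; congr (_ *: _).
rewrite (linear_sum_of _ _ (act_linearr y)) (linear_sum_of _ _ (fr_out_linear fr)).
rewrite linear_sum (bigD1 i) //= -actM fr_outK linearZ /= coord_basis eqxx mulr1.
rewrite big1 ?addr0 // => j ij.
by rewrite -actM fr_outK linearZ /= coord_basis eq_sym (negPf ij) mulr0.
Qed.

Lemma fr_to_dsumK : cancel fr_to_dsum fr_of_dsum.
Proof.
move=> v; rewrite -[RHS](fr_span fr) /fr_of_dsum.
under eq_bigr => i _.
  rewrite ffunE fr_coordE.
  rewrite (linear_tsum _ _ (act_linearl _)) /tsum.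
  over.
rewrite exchange_big; apply: eq_bigr => p _ /=.
rewrite {2}[e _]fr_basis_sum (linear_sum_of _ _ (fr_in_linear fr)).
rewrite (linear_sum_of _ _ (act_linearr _)); apply: eq_bigr => i _.
rewrite (linearZ_of _ _ (act_linearl _)).
by rewrite (linearZ_of _ _ (fr_in_linear fr)) (linearZ_of _ _ (act_linearr _)).
Qed.

(** The two framing identities say that (f_i)_i |-> sum_i f_i.u(b_i), for a basis b of W, and
    the coordinates of the reconstruction formula are inverse to each other. *)
Lemma framing_iso : exists h : rep_hom X (dsum n (unit_rep A)),
  h =1 fr_to_dsum /\ @is_iso (Rep A) _ _ h.
Proof.
have [f fE] := rep_hom_exists fr_of_dsum_linear fr_of_dsum_act.
have fK : cancel f fr_to_dsum by move=> x; rewrite fE fr_of_dsumK.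
have gK : cancel fr_to_dsum f by move=> x; rewrite fE fr_to_dsumK.
by have [h [hE [hf fh]]] := rep_iso_inv fK gK; exists h; split=> //; exists f.
Qed.

(** An invariant v yields the morphisms a |-> a.v from A_t; their components in A_t^n are
    endomorphisms of A_t, hence scalars by connectedness, so that v is a combination of the
    vectors 1 (x) w. *)
Lemma fr_Inv v : connected A -> Inv v -> exists w, u w = v.
Proof.
move=> [_ _ endA] vI; have [h [hE _]] := framing_iso.
have cP i : exists c, h v i = c *: unit_one A.
  pose g (a : unit_rep A) : unit_rep A := h (act (At_val a) v) i.
  have lg : linear g.
    by move=> c x y; rewrite /g At_val_linear act_linearl linearP !ffunE.
  have ga a x : g (act a x) = act a (g x).
    by rewrite /g -vI actM rep_lfun_act ffunE.
  have [f fE] := rep_hom_exists lg ga; have [c fc] := endA f; exists c.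
  by rewrite -fc fE /g unit_oneE act1.
have [c hc] := choice cP.
exists (\sum_i c i *: tnth b i); rewrite -[RHS]fr_to_dsumK.
rewrite (linear_sum_of _ _ (fr_in_linear fr)) /fr_of_dsum; apply: eq_bigr => i _.
rewrite -hE hc (linearZ_of _ _ (@At_val_linear F A)) (linearZ_of _ _ (act_linearl _)).
by rewrite (linearZ_of _ _ (fr_in_linear fr)) unit_oneE act1.
Qed.

End Theory.

Section Morphism.
Variables (X X' : rep A) (W W' : vectType F).
Variables (fr : framing X W) (fr' : framing X' W') (f : rep_hom X X').
Hypothesis A_connected : connected A.

(** Morphisms preserve invariants, so by [fr_Inv] every morphism A_t (x) W -> A_t (x) W' has
    the form id (x) g. *)
Lemma framing_hom : exists g : W -> W',
  [/\ linear g, forall w, f (fr_in fr w) = fr_in fr' (g w) &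
      forall v, fr_out fr' (f v) = g (fr_out fr v)].
Proof.
have gP w : exists w', fr_in fr' w' = f (fr_in fr w).
  by apply: fr_Inv => // a; rewrite -!rep_lfun_act -fr_inv.
have [g fg] := choice gP.
have lg : linear g.
  move=> c x y; apply: (fr_in_inj (fr := fr')).
  by rewrite fr_in_linear !fg fr_in_linear linearP.
exists g; split=> // v; move: v; apply: (fr_ind (fr := fr)) => [||a w].
- exact: linear_comp (fr_out_linear fr') (linearP f).
- exact: linear_comp lg (fr_out_linear fr).
by rewrite rep_lfun_act -fg !fr_outK (linearZ_of _ _ lg).
Qed.
End Morphism.

(** Transport the framing w |-> (w_i 1)_i, (x_i)_i |-> (eps(x_i))_i of A_t^n. *)
Lemma dsum_framing n (X : rep A) :
  @isomorphic (Rep A) X (dsum n (unit_rep A)) -> inhabited (framing X 'cV[F]_n).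
Proof.
move=> [f [g [gf fg]]].
have fgK v : f (g v) = v.
  have := congr1 (fun h : rep_hom _ _ => h v) fg.
  by rewrite /= comp_lfunE id_lfunE.
have gfK v : g (f v) = v.
  have := congr1 (fun h : rep_hom _ _ => h v) gf.
  by rewrite /= comp_lfunE id_lfunE.
pose u (w : 'cV[F]_n) : X := g [ffun i => w i 0 *: unit_one A].
pose e (v : X) : 'cV[F]_n := \col_i eps A (At_val (f v i)).
have lu : linear u.
  move=> c w w'; rewrite /u -linearP; congr (g _); apply/ffunP=> i.
  by rewrite !ffunE !mxE scalerDl scalerA.
have le : linear e.
  by move=> c v v'; apply/colP=> i; rewrite !mxE linearP !ffunE At_val_linear linearP.
constructor; apply: (@Framing X _ u e) => // [a w|v].
  apply/colP=> i; rewrite !mxE -rep_lfun_act fgK !ffunE.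
  rewrite (linearZ_of _ _ (act_linearr a)) act_unit_one.
  rewrite (linearZ_of _ _ (@At_val_linear F A)).
  by rewrite linearZ /= eps_epst mulrC.
apply: (can_inj gfK); apply/ffunP=> i; apply: val_inj.
have lfi : linear (fun v => At_val (f v i)).
  by move=> c x y; rewrite linearP !ffunE At_val_linear.
rewrite [LHS](linear_tsum _ _ lfi) -[RHS]epst_At -[RHS]epst_eps_Delta1.
apply: eq_tsum => x y; rewrite rep_lfun_act fgK !ffunE.
rewrite (linearZ_of _ _ (act_linearr _)) act_unit_one mxE.
rewrite (linearZ_of _ _ (@At_val_linear F A)) /= epst_idem.
by have -> := rep_lfun_act f y v; rewrite ffunE /= eps_epst.
Qed.

End Framing.

(** * Framings along a weak Hopf algebra homomorphism *)

Section Homomorphism.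
Variables (F : fieldType) (A B : weakHopf F) (k : {lrmorphism A -> B}).
Hypothesis k_hom : is_wh_hom k.

Lemma tsum_Delta1_hom (Z : lmodType F) (K : B -> B -> Z) : bilin K ->
  tsum (Delta B 1) K = \tsum_(x, y <- Delta A 1) K (k x) (k y).
Proof.
move=> bK; rewrite -(rmorph1 k) (wh_hom_Delta k_hom) tsum_tsum //.
by apply: eq_tsum => x y; rewrite tsum_pure.
Qed.

Lemma hom_epst a : k (epst a) = epst (k a).
Proof.
rewrite [in RHS]/epst (wh_hom_Delta k_hom) tsum_tsum.
  rewrite (linear_tsum _ _ (linearP k)); apply: eq_tsum => x y.
  rewrite tsum_pure ?rmorphM ?(wh_hom_antipode k_hom) //.
  exact: bilin_comp (@linear_id _ _) (linearP _) (@mul_bilin F B).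
exact: bilin_comp (@linear_id _ _) (linearP _) (@mul_bilin F B).
Qed.

Section FramedModule.
Variables (V : rep B) (W : vectType F) (fr : framing (restr k V) W).
Local Notation u := (fr_in fr : W -> V).
Local Notation e := (fr_out fr : V -> W).

Lemma act_bilin : bilin (@act F B V).
Proof. by split; [exact: act_linearl|exact: act_linearr]. Qed.

(** Since k maps Delta(1) to Delta(1), the reconstruction formulas of a framing of k^*(V)
    only involve the action of B. *)
Lemma fr_span_rep v :
  \tsum_(x, y <- Delta B 1) act (antipode B x) (u (e (act y v))) = v.
Proof.
have bK : bilin (fun x y : B => act x (u (e (act y v)))).
  apply: (bilin_comp (@linear_id _ _)) act_bilin.
  apply: linear_comp (fr_in_linear fr) (linear_comp (fr_out_linear fr) _).
  exact: act_linearl.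
rewrite -(antipode_Delta1 (K := fun x y => act x (u (e (act y v))))) //.
rewrite tsum_Delta1_hom; last first.
  exact: bilin_comp (@epst_linear F B) (@linear_id _ _) bK.
rewrite -[RHS](fr_span fr); apply: eq_tsum => x y.
by rewrite -hom_epst.
Qed.

Lemma fr_span_rep_antipode v :
  \tsum_(x, y <- Delta B 1) act x (u (e (act (antipode B y) v))) = v.
Proof.
rewrite tsum_Delta1_hom; last first.
  apply: (bilin_comp (@linear_id _ _)) act_bilin.
  apply: linear_comp (fr_in_linear fr) (linear_comp (fr_out_linear fr) _).
  exact: linear_comp (act_linearl v) (linearP _).
rewrite -[RHS](fr_span_antipode fr); apply: eq_tsum => x y.
by rewrite (wh_hom_antipode k_hom).
Qed.

End FramedModule.

(** * The relative restriction is framed *)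

Section RelativeRestriction.
Variables (H : algType F) (p : birel_mult B H).
Hypothesis p_trivial : trivial_on k p.

Section Module.
Variable M : rep H.

Let out_bilin : bilin (fun (x : At B) (m : M) => act (p (At_val x)) m).
Proof.
split=> [m|x]; last exact: act_linearr.
apply: linear_comp (act_linearl m) _.
exact: linear_comp (linearP p) (@At_val_linear F B).
Qed.

(** The first birelative identity, acting on a module; it is the reason why [rr_out] respects
    the relations of the relative restriction. *)
Lemma act_birel_S1t (b : B) (m : M) :
  \tsum_(s, y <- S1t B) act (p (At_val s)) (act (p (y * b)) m) = act (p b) m.
Proof.
rewrite (tsum_S1t_val (E := fun s y => act (p s) (act (p (y * b)) m))).
  rewrite -[b in RHS]mul1r -birel_multl (linear_tsum _ _ (act_linearl m)).
  by apply: eq_tsum => x y; rewrite actM mul1r.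
split=> [y|x].
  exact: linear_comp (act_linearl _) (linearP p).
apply: linear_comp (act_linearr _) (linear_comp (act_linearl _) _).
exact: linear_comp (linearP p) (mull_linear b).
Qed.

Definition rr_in (m : M) : rr_quot p M := rr_box p (epsAt 1) m.

(** The map x (x) m |-> pi(x) m. On x = k(a) with a in A_t it is eps(a) m, the second map of a
    framing. *)
Definition rr_out : rr_quot p M -> M :=
  llift (fun t : tensor (At B) M => \tsum_(x, m <- t) act (p (At_val x)) m).

Let out_rel (t : tensor (At B) M) : rr_rel p t -> \tsum_(x, m <- t) act (p (At_val x)) m = 0.
Proof.
move=> [x [m ->]]; rewrite (linearB_of (tsumP out_bilin)) tsum_tsum // tsum_pure //.
under eq_tsum do rewrite tsum_pure //.
by rewrite act_birel_S1t subrr.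
Qed.

Lemma rr_out_linear : linear rr_out.
Proof. exact: llift_linear (tsumP out_bilin) out_rel. Qed.

Lemma rr_out_box x (m : M) : rr_out (rr_box p x m) = act (p (At_val x)) m.
Proof.
by rewrite /rr_out /rr_box lliftE ?tsum_pure //; exact: tsumP.
Qed.

Lemma rr_out_act b x (m : M) : rr_out (rr_act b (rr_box p x m)) = act (p (b * At_val x)) m.
Proof.
rewrite rr_actE (linear_tsum _ _ rr_out_linear) -act_birel_S1t.
by apply: eq_tsum => s y; rewrite rr_out_box mulrA.
Qed.

Lemma rr_act_in b (m : M) :
  rr_act b (rr_in m) = \tsum_(s, y <- S1t B) rr_box p s (act (p (y * b)) m).
Proof. by rewrite rr_actE; under eq_tsum do rewrite /= epst1 mulr1. Qed.

Lemma rr_act_At (x : At B) (m : M) : rr_act (At_val x) (rr_in m) = rr_box p x m.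
Proof. by rewrite rr_act_in -rr_boxE. Qed.

Lemma rr_in_linear : linear rr_in.
Proof. exact: (rr_box_bilin p M).2. Qed.

Lemma rr_out_in a m : rr_out (rr_act a (rr_in m)) = act (p a) m.
Proof. by rewrite rr_out_act /= epst1 mulr1. Qed.

Lemma rr_outK a m : rr_out (rr_act (k a) (rr_in m)) = eps A a *: m.
Proof. by rewrite rr_out_in p_trivial (linearZ_of _ _ (act_linearl m)) act1. Qed.

(** On x (x) m the terms are pi(y' S(1_(1))) pi(1_(2) x) m, and the first birelative identity
    contracts them to the defining relation of the class of x (x) m. *)
Lemma rr_span v :
  \tsum_(x, y <- Delta A 1) rr_act (k (epst x)) (rr_in (rr_out (rr_act (k y) v))) = v.
Proof.
move: v; apply: rr_ind => [c v w||x m].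
- apply: tsum_lin => x y; rewrite rr_act_linearr rr_out_linear.
  by rewrite rr_in_linear rr_act_linearr.
- exact: linear_id.
pose K (y z : B) := rr_act y (rr_in (act (p (z * At_val x)) m)).
have bK : bilin K.
  split=> [z|y]; first exact: rr_act_linearl.
  apply: linear_comp (rr_act_linearr y) _.
  apply: linear_comp ((rr_box_bilin p M).2 _) _.
  apply: linear_comp (act_linearl m) _.
  exact: linear_comp (linearP p) (mull_linear _).
transitivity (\tsum_(y, z <- Delta B 1) K (epst y) z).
  rewrite tsum_Delta1_hom; last first.
    exact: bilin_comp (@epst_linear F B) (@linear_id _ _) bK.
  by apply: eq_tsum => y z; rewrite rr_out_act hom_epst.
rewrite antipode_Delta1 // [RHS]rr_boxE /K.
under eq_tsum do rewrite rr_act_in.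
rewrite exchange_tsum; apply: eq_tsum => s y.
rewrite -(linear_tsum _ _ ((rr_box_bilin p M).2 s)); congr rr_box.
by rewrite -birel_multl (linear_tsum _ _ (act_linearl m)); apply: eq_tsum => z t; rewrite actM.
Qed.
Definition rr_framing : framing (restr k (rr_rep p M)) M :=
  @Framing F A (restr k (rr_rep p M)) M rr_in rr_out
    rr_in_linear rr_out_linear rr_outK rr_span.
End Module.

Lemma rr_Ker_obj (M : rep H) : @Ker_obj F A B k (rr_rep p M).
Proof.
have [h [_ h_iso]] := framing_iso (rr_framing M).
by exists (\dim (fullv : {vspace M})), h.
Qed.

End RelativeRestriction.
End Homomorphism.

(** * Two consequences of the universal property of the cokernel *)

Section Subalgebra.
Variables (F : fieldType) (H : algType F) (S : subalgClosed H).

Record subalg := Subalg { subalg_val :> H; _ : subalg_val \in S }.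
HB.instance Definition _ := [isSub for subalg_val].
HB.instance Definition _ := [Choice of subalg by <:].
HB.instance Definition _ := [SubChoice_isSubAlgebra of subalg by <:].
HB.instance Definition _ := GRing.Linear.copy subalg_val (val : subalg -> H).
HB.instance Definition _ := GRing.RMorphism.copy subalg_val (val : subalg -> H).

End Subalgebra.

Section Cokernel.
Variables (F : fieldType) (A B : weakHopf F) (k : {lrmorphism A -> B}).
Variables (H : algType F) (p : birel_mult B H).
Hypothesis p_coker : is_cokernel k p.

(** The corestriction of pi to S is again a test map, so it factors through H; composing
    with the inclusion of S gives an endomorphism of H fixing pi, which is the identity. *)
Lemma coker_generated (S : subalgClosed H) :
  (forall b, p b \in S) -> forall h, h \in S.
Proof.
move=> pS.
pose q b : subalg S := Subalg (pS b).
have lq : linear q by move=> c a b; apply: val_inj; rewrite /= linearP.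
have ql a b :
    \tsum_(x, y <- Delta B 1) (q (a * antipode B x) * q (y * b)) = q (a * b).
  apply: val_inj; rewrite [RHS]/= -birel_multl.
  exact: linear_tsum (linearP (val : subalg S -> H)).
have qr a b :
    \tsum_(x, y <- Delta B 1) (q (a * x) * q (antipode B y * b)) = q (a * b).
  apply: val_inj; rewrite [RHS]/= -birel_multr.
  exact: linear_tsum (linearP (val : subalg S -> H)).
pose qL : {linear B -> subalg S} := HB.pack q (GRing.isLinear.Build F B (subalg S) _ q lq).
have [p_triv p_univ] := p_coker.
have q_triv : trivial_on k (@BirelMult F B (subalg S) qL ql qr).
  by move=> a; apply: val_inj; rewrite /= p_triv.
have [g [gE _]] := p_univ _ _ q_triv.
have [i [iE i_uniq]] := p_univ _ _ p_triv.
move=> h.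
have idE : h = i h by apply: (i_uniq idfun).
have vgE : subalg_val (g h) = i h.
  apply: (i_uniq (@subalg_val _ _ S \o g)) => b; by rewrite /= gE.
by rewrite idE -vgE; apply: valP.
Qed.

(** Size 0 is separate because matrices of that size form the zero algebra, which is not an
    algType; all equations between them are trivial. *)
Lemma coker_matrix n (T : B -> 'M[F]_n) : linear T ->
    (forall a b, \tsum_(x, y <- Delta B 1) (T (a * antipode B x) *m T (y * b)) =
      T (a * b)) ->
    (forall a b, \tsum_(x, y <- Delta B 1) (T (a * x) *m T (antipode B y * b)) =
      T (a * b)) ->
    (forall a, T (k a) = (eps A a)%:M) ->
  exists r : H -> 'M[F]_n,
    [/\ linear r, r 1 = 1%:M, forall g h, r (g * h) = r g *m r h &
        forall b, r (p b) = T b].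
Proof.
case: n T => [|n] T lT Tl Tr Tk.
  have eq_mx0 (X Y : 'M[F]_0) : X = Y by apply/matrixP=> -[].
  by exists (fun=> 0); split=> [c x y||x y|b]; apply: eq_mx0.
pose TL : {linear B -> 'M[F]_n.+1} := HB.pack T (GRing.isLinear.Build F B 'M[F]_n.+1 _ T lT).
have [_ p_univ] := p_coker.
have [|g [gE _]] := p_univ _ (@BirelMult F B 'M[F]_n.+1 TL Tl Tr).
  by move=> a; rewrite -[LHS]/(T (k a)) Tk -scalemx1.
by exists g; split=> [c x y||x y|]; rewrite ?linearP ?rmorph1 ?rmorphM.
Qed.

End Cokernel.

(** * Reconstructing a representation of the cokernel *)

Section FramedIso.
Variables (F : fieldType) (A B : weakHopf F) (k : {lrmorphism A -> B}).
Hypothesis k_hom : is_wh_hom k.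
Variables (H : algType F) (p : birel_mult B H).
Variables (V : rep B) (M : rep H) (fr : framing (restr k V) M).
Local Notation u := (fr_in fr : M -> V).
Local Notation e := (fr_out fr : V -> M).
Hypothesis actpE : forall b m, act (p b) m = e (act b (u m)).

Let pre (t : tensor (At B) M) : V := \tsum_(x, m <- t) act (At_val x) (u m).

Let pre_bilin : bilin (fun (x : At B) (m : M) => act (At_val x) (u m)).
Proof. exact: bilin_comp (@At_val_linear F B) (fr_in_linear fr) (act_bilin V). Qed.

Let fr_span_S1t (v : V) : \tsum_(s, y <- S1t B) act (At_val s) (u (e (act y v))) = v.
Proof.
rewrite (tsum_S1t_val (E := fun s y => act s (u (e (act y v))))) ?fr_span_rep //.
apply: (bilin_comp (@linear_id _ _)) (act_bilin V).
apply: linear_comp (fr_in_linear fr) (linear_comp (fr_out_linear fr) _).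
exact: act_linearl.
Qed.

Let pre_rel t : rr_rel p t -> pre t = 0.
Proof.
move=> [x [m ->]]; rewrite [LHS](linearB_of (tsumP pre_bilin)) tsum_tsum // tsum_pure //.
rewrite -[X in X - _]fr_span_S1t; apply/eqP; rewrite subr_eq0; apply/eqP.
by apply: eq_tsum => s y; rewrite tsum_pure // actpE actM.
Qed.

Let f : rr_quot p M -> V := llift pre.

Let f_box x m : f (rr_box p x m) = act (At_val x) (u m).
Proof. by rewrite /f /rr_box lliftE /pre ?tsum_pure //; exact: tsumP. Qed.

Let f_linear : linear f.
Proof. exact: llift_linear (tsumP pre_bilin) pre_rel. Qed.

Let f_act b q : f (rr_act b q) = act b (f q).
Proof.
move: q; apply: rr_ind => [||x m].
- exact: linear_comp f_linear (rr_act_linearr b).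
- exact: linear_comp (act_linearr b) f_linear.
rewrite rr_actE (linear_tsum _ _ f_linear) f_box -actM.
rewrite -[RHS]fr_span_S1t; apply: eq_tsum => s y.
by rewrite f_box actpE -actM mulrA.
Qed.

(** The inverse of x (x) m |-> x.u(m) is the reconstruction formula [fr_span_S1t] read in
    the relative restriction. *)
Let g (v : V) : rr_quot p M := \tsum_(s, y <- S1t B) rr_box p s (e (act y v)).

Let g_linear : linear g.
Proof.
move=> c v w; apply: tsum_lin => s y.
by rewrite act_linearr (fr_out_linear fr) (rr_box_bilin p M).2.
Qed.

Let fK : cancel f g.
Proof.
apply: rr_ind => [||x m]; [exact: linear_comp g_linear f_linear|exact: linear_id|].
rewrite f_box [RHS]rr_boxE; apply: eq_tsum => s y.
by rewrite actpE actM.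
Qed.

Let gK : cancel g f.
Proof.
move=> v; rewrite -[RHS]fr_span_S1t /g (linear_tsum _ _ f_linear).
by apply: eq_tsum => s y; rewrite f_box.
Qed.

(** If pi(b) acts on M as e(b.u(-)), the map x (x) m |-> x.u(m) respects the relations and
    the action by the same reconstruction formula. *)
Lemma framed_rr_iso : @isomorphic (Rep B) (rr_rep p M) V.
Proof.
have [h hE] := @rep_hom_exists F B (rr_rep p M) V f f_linear f_act.
exists h; apply: (@rep_isoP F B (rr_rep p M) V h g) => v.
  by rewrite hE fK.
by rewrite hE gK.
Qed.
End FramedIso.

Section Reconstruction.
Variables (F : fieldType) (A B : weakHopf F) (k : {lrmorphism A -> B}).
Hypothesis k_hom : is_wh_hom k.
Variables (H : algType F) (p : birel_mult B H).
Hypothesis p_coker : is_cokernel k p.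
Variables (V : rep B) (n : nat) (fr : framing (restr k V) 'cV[F]_n).
Local Notation u := (fr_in fr : 'cV[F]_n -> V).
Local Notation e := (fr_out fr : V -> 'cV[F]_n).

(** The matrix of e(b.u(-)). Both birelative identities for T are reconstruction formulas,
    and its triviality on A is the first framing identity. *)
Let T b : 'M[F]_n := \matrix_(i, j) e (act b (u (delta_mx j 0))) i 0.

Let T_mul b w : T b *m w = e (act b (u w)).
Proof.
have l : linear (fun w => e (act b (u w))).
  by move=> c x y; rewrite (fr_in_linear fr) act_linearr (fr_out_linear fr).
rewrite -[RHS]/((fun w => e (act b (u w))) w) [in RHS](matrix_sum_delta w).
rewrite (linear_sum_of _ _ l); apply/colP=> i; rewrite mxE summxE.
apply: eq_bigr => j _; rewrite big_ord1 (linearZ_of _ _ l) !mxE mulrC.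
by congr (_ * _); rewrite ?[0]ord1.
Qed.

Let mul_cV_inj (X Y : 'M[F]_n) : (forall w : 'cV[F]_n, X *m w = Y *m w) -> X = Y.
Proof.
move=> XY; apply/matrixP=> i j; have := congr1 (fun C : 'cV_n => C i 0) (XY (delta_mx j 0)).
by rewrite -!colE !mxE.
Qed.

Let T_linear : linear T.
Proof.
move=> c a b; apply/matrixP=> i j; rewrite !mxE act_linearl.
by rewrite (fr_out_linear fr) !mxE.
Qed.

Let T_multl a b :
  \tsum_(x, y <- Delta B 1) (T (a * antipode B x) *m T (y * b)) = T (a * b).
Proof.
apply: mul_cV_inj => w.
rewrite T_mul actM -[in RHS](fr_span_rep k_hom fr (act b (u w))).
rewrite (linear_tsum _ _ (act_linearr a)) (linear_tsum _ _ (fr_out_linear fr)).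
rewrite /tsum mulmx_suml; apply: eq_bigr => q _.
by rewrite -mulmxA !T_mul !actM.
Qed.

Let T_multr a b :
  \tsum_(x, y <- Delta B 1) (T (a * x) *m T (antipode B y * b)) = T (a * b).
Proof.
apply: mul_cV_inj => w.
rewrite T_mul actM -[in RHS](fr_span_rep_antipode k_hom fr (act b (u w))).
rewrite (linear_tsum _ _ (act_linearr a)) (linear_tsum _ _ (fr_out_linear fr)).
rewrite /tsum mulmx_suml; apply: eq_bigr => q _.
by rewrite -mulmxA !T_mul !actM.
Qed.

Let T_trivial a : T (k a) = (eps A a)%:M.
Proof.
by apply: mul_cV_inj => w; rewrite T_mul -scalemx1 -scalemxAl mul1mx -(fr_outK fr).
Qed.

Lemma framing_rep_iso : exists M : rep H, @isomorphic (Rep B) (rr_rep p M) V.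
Proof.
have [r [lr r1 rM rp]] := coker_matrix p_coker T_linear T_multl T_multr T_trivial.
pose a h (w : 'cV[F]_n) := r h *m w.
have al w : linear (a^~ w) by move=> c x y; rewrite /a lr mulmxDl -scalemxAl.
have ar h : linear (a h) by move=> c x y; rewrite /a mulmxDr -scalemxAr.
have a1 w : a 1 w = w by rewrite /a r1 mul1mx.
have aM x y w : a (x * y) w = a x (a y w) by rewrite /a rM mulmxA.
exists (MkRep al ar a1 aM).
apply: (framed_rr_iso k_hom (M := MkRep al ar a1 aM) (fr := fr)) => b w.
by rewrite /= /a rp T_mul.
Qed.
End Reconstruction.

(** * Equivalences from fully faithful, essentially surjective functors *)

Section Equivalence.
Variables (C D : category) (G : functor C D).
Hypothesis G_faithful : forall X Y (f g : Mor X Y), fmor G f = fmor G g -> f = g.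
Hypothesis G_full : forall X Y (h : Mor (G X) (G Y)), exists f, fmor G f = h.
Hypothesis G_esurj : forall Y, exists X, isomorphic (G X) Y.

Lemma ff_esurj_equivalence : equivalence G.
Proof.
have [K KP] := choice G_esurj.
pose i Y := sval (cid (KP Y)).
pose j Y := sval (cid (svalP (cid (KP Y)))).
have ijP Y : Defs.comp (j Y) (i Y) = idm _ /\ Defs.comp (i Y) (j Y) = idm _.
  exact: svalP (cid (svalP (cid (KP Y)))).
pose lift X Y (h : Mor (G X) (G Y)) := sval (cid (G_full h)).
have liftE X Y (h : Mor (G X) (G Y)) : fmor G (lift X Y h) = h.
  exact: svalP (cid (G_full h)).
pose Kmor Y Y' (h : Mor Y Y') := lift _ _ (Defs.comp (j Y') (Defs.comp h (i Y))).
have K1 Y : Kmor Y Y (idm Y) = idm (K Y).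
  by apply: G_faithful; rewrite liftE comp1m (ijP Y).1 fmor1.
have KM X Y Z (f : Mor Y Z) (g : Mor X Y) :
    Kmor _ _ (Defs.comp f g) = Defs.comp (Kmor _ _ f) (Kmor _ _ g).
  apply: G_faithful; rewrite fmorM !liftE -!Defs.compA; congr (Defs.comp _ (Defs.comp _ _)).
  by rewrite (Defs.compA (i Y)) (ijP Y).2 comp1m.
exists (@Functor D C K Kmor K1 KM); split.
  exists (fun X => lift _ _ (i (G X))); split=> [X Y f|X] /=.
    apply: G_faithful; rewrite !fmorM !liftE.
    by rewrite Defs.compA (ijP _).2 comp1m.
  exists (lift _ _ (j (G X))); split; apply: G_faithful.
    by rewrite fmorM !liftE (ijP _).1 fmor1.
  by rewrite fmorM !liftE (ijP _).2 fmor1.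
exists i; split=> [X Y f|X]; last by exists (j X); apply: ijP.
by rewrite /= liftE Defs.compA (ijP _).2 comp1m.
Qed.
End Equivalence.

(** * The relative restriction is fully faithful *)

Section Commutant.
Variables (F : fieldType) (H : algType F) (M N : rep H) (f : 'Hom(M, N)).

Definition commutant : {pred H} := fun h => `[< forall m, f (act h m) = act h (f m) >].

Lemma commutant_closed : subalg_closed commutant.
Proof.
split=> [|c x y|x y].
- by apply/asboolP=> m; rewrite !act1.
- move=> /asboolP fx /asboolP fy; apply/asboolP=> m.
  rewrite !act_linearl linearP; congr (_ *: _ + _); [exact: fx|exact: fy].
move=> /asboolP fx /asboolP fy; apply/asboolP=> m.
by rewrite !actM fx fy.
Qed.

HB.instance Definition _ := GRing.isSubalgClosed.Build F H commutant
  (GRing.subalg_closed_semi commutant_closed).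

End Commutant.

Section FullyFaithful.
Variables (F : fieldType) (A B : weakHopf F) (k : {lrmorphism A -> B}).
Hypotheses (A_connected : connected A) (k_hom : is_wh_hom k).
Variables (H : algType F) (p : birel_mult B H).
Hypothesis p_coker : is_cokernel k p.
Variables M N : rep H.

Lemma rr_hom_faithful (f g : rep_hom M N) : rr_hom p f = rr_hom p g -> f = g.
Proof.
move=> fg; apply: rep_hom_eq => m.
apply: (fr_in_inj (fr := rr_framing k_hom p_coker.1 N)).
have := congr1 (fun h : rep_hom (rr_rep p M) (rr_rep p N) => h (rr_in p m)) fg.
by rewrite /= !rr_lfunE !rr_mapE.
Qed.

(** By [framing_hom] a morphism is id (x) g. Comparing rr_out on both sides, g commutes with
    all pi(b), hence with H by [coker_generated]. *)
Lemma rr_hom_full (f : rep_hom (rr_rep p M) (rr_rep p N)) : exists g, rr_hom p g = f.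
Proof.
have [g [lg fg gf]] := framing_hom (rr_framing k_hom p_coker.1 M)
  (rr_framing k_hom p_coker.1 N) (restr_hom k f) A_connected.
pose gL : {linear M -> N} := HB.pack g (GRing.isLinear.Build F M N _ g lg).
have gE : linfun gL =1 g by move=> x; rewrite lfunE.
have g_act h m : linfun gL (act h m) = act h (linfun gL m).
  suff /asboolP : h \in commutant (linfun gL) by [].
  apply: (coker_generated p_coker) => b; apply/asboolP=> {}m.
  rewrite !gE -!rr_out_in -[LHS]gf; congr rr_out.
  by rewrite [LHS](rep_lfun_act f); exact: congr1 (fg m).
exists (MkRepHom g_act); apply: rep_hom_eq => q.
rewrite /= rr_lfunE; move: q; apply: rr_ind => [||x m].
- exact: rr_map_linear.
- exact: (linearP (rep_lfun f)).
rewrite rr_mapE /= gE -!rr_act_At.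
by rewrite [RHS](rep_lfun_act f); exact: congr1 (esym (fg m)).
Qed.
End FullyFaithful.

(** * The equivalence *)

Theorem theorem4p11 (F : fieldType) (A B : weakHopf F)
    (A_connected : connected A) (B_connected : connected B)
    (k : {lrmorphism A -> B}) (k_hom : is_wh_hom k) (k_normal : inv_normal k)
    (H : algType F) (p : birel_mult B H) (p_coker : is_cokernel k p) :
  exists in_Ker : forall M : Rep H, Ker_obj k (rel_restriction p M),
    equivalence (corestrict in_Ker : functor (Rep H) (Ker k)).
Proof.
exists (rr_Ker_obj k_hom p_coker.1); apply: ff_esurj_equivalence => [M N f g|M N f|].
- by move=> fg; apply: (rr_hom_faithful k_hom p_coker fg).
- by have [h hf] := rr_hom_full A_connected k_hom p_coker f; exists h.
move=> [V V_Ker]; have [n V_iso] := V_Ker.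
have [fr] := dsum_framing V_iso.
by have [M M_iso] := framing_rep_iso k_hom p_coker fr; exists M.
Qed.
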